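(* Let $F$ be a minimally unsatisfiable clause-set with deficiency $\delta(F) = c(F)-n(F) = 2$. Then any two elements of $\mathrm{sDP}(F)$ are isomorphic.
   Context: Literals are variables $v$ and complements $\overline{v}$; a clause is a finite set of literals with no complementary pair; a clause-set is a finite set of clauses; $\mathrm{var}(F)$ is the set of variables of $F$, $n(F)=|\mathrm{var}(F)|$, $c(F)=|F|$; $\mathrm{ldeg}_F(x)$ is the number of clauses of $F$ containing literal $x$. $\mathrm{DP}_v(F) := \{C \in F : v \notin \mathrm{var}(C)\} \cup \{(C \cup D)\setminus\{v,\overline{v}\} : C, D \in F,\ C \cap \overline{D} = \{v\}\}$. $\mathrm{MU}$ is the set of minimally unsatisfiable clause-sets. A variable $v$ is singular for $F$ if $\min(\mathrm{ldeg}_F(v),\mathrm{ldeg}_F(\overline{v}))=1$; $F$ is nonsingular if it has none. A singular DP-reduction step is $F\leadsto \mathrm{DP}_v(F)$ for $F\in\mathrm{MU}$ and $v$ singular for $F$. $\mathrm{sDP}(F)$ is the set of nonsingular $F'\in\mathrm{MU}$ obtainable from $F$ by zero or more singular DP-reduction steps. Clause-sets $F,G$ are isomorphic if there is a bijection on literals commuting with complementation mapping the clauses of $F$ exactly onto the clauses of $G$. *)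

(* Defs.v *)
From mathcomp Require Import all_boot.
From mathcomp Require Import finmap.
Set Implicit Arguments. Unset Strict Implicit. Unset Printing Implicit Defensive.
Local Open Scope fset_scope.

(* Variables are natural numbers; a literal is a pair (v, b):
   (v, true) is the positive literal v, (v, false) is its complement. *)
Definition var := nat.
Definition lit := (nat * bool)%type.
Definition compl (x : lit) : lit := (x.1, ~~ x.2).

Definition clause := {fset lit}.
Definition clauseset := {fset clause}.

Definition is_clause (C : clause) : Prop := forall x, x \in C -> compl x \notin C.
Definition is_clauseset (F : clauseset) : Prop := forall C, C \in F -> is_clause C.

Definition varC (C : clause) : {fset nat} := [fset x.1 | x in C].
Definition varF (F : clauseset) : {fset nat} := \bigcup_(C <- F) varC C.
Definition nvars (F : clauseset) : nat := #|` varF F|.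
Definition ncls (F : clauseset) : nat := #|` F|.

Definition ldeg (F : clauseset) (x : lit) : nat := #|` [fset C in F | x \in C]|.

Definition complC (D : clause) : clause := [fset compl y | y in D].

Definition DP (v : nat) (F : clauseset) : clauseset :=
  [fset C in F | v \notin varC C] `|`
  [fset ((C `|` D) `\` [fset (v, true); (v, false)]) | C in F, D in F
     & C `&` complC D == [fset (v, true)]].

Definition sat_clause (f : nat -> bool) (C : clause) : bool :=
  [exists x : C, f (val x).1 == (val x).2].
Definition satisfiable (F : clauseset) : Prop :=
  exists f : nat -> bool, forall C, C \in F -> sat_clause f C.

Definition MU (F : clauseset) : Prop :=
  is_clauseset F /\ ~ satisfiable F /\
  forall C, C \in F -> satisfiable (F `\ C).

Definition singular (F : clauseset) (v : nat) : Prop :=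
  minn (ldeg F (v, true)) (ldeg F (v, false)) = 1.
Definition nonsingular (F : clauseset) : Prop := forall v, ~ singular F v.

Definition sDP_step (F G : clauseset) : Prop :=
  MU F /\ exists v, singular F v /\ G = DP v F.

Inductive sDP_reach : clauseset -> clauseset -> Prop :=
  | sDP_refl F : sDP_reach F F
  | sDP_trans F G H : sDP_step F G -> sDP_reach G H -> sDP_reach F H.

Definition in_sDP (F F' : clauseset) : Prop :=
  sDP_reach F F' /\ MU F' /\ nonsingular F'.

Definition isomorphic (F G : clauseset) : Prop :=
  exists f : lit -> lit, bijective f /\ (forall x, f (compl x) = compl (f x)) /\
    [fset [fset f x | x in C] | C : clause in F] = G.

(* Main.v *)
(* Write n(T) for the number of variables of T and d(T) = |T| - n(T).

   Number of steps. Singular DP-reduction on a literal x occurring only in the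
   clause C maps F \ C injectively onto the reduct. Reductions with different
   main clauses commute, and a variable of degrees (1,1) has two possible main
   clauses, so it can always be eliminated first. Once there is no such
   variable, every step removes exactly one of the clauses that contain a
   literal of degree 1. Hence all results of F have the same number of variables.

   Nonsingular case. Let F be nonsingular in MU with d(F) = 2. By Hall's theorem
   d(J) < d(F) for every proper subset J of a minimally unsatisfiable F, and a
   minimally unsatisfiable clause-set with d = 1 and at least one variable has a
   variable of degrees (1,1). Applying this to the clauses outside J, restricted
   to the variables not in J, shows that d(J) < 0 for nonempty J unless
   |F \ J| <= 2. Splitting F at a literal x then gives that x has degree 2 and
   that F without the two x-clauses is, after deleting the variable of x,
   minimally unsatisfiable with d = 1; so the two x-clauses clash in some y.
   Splitting at the complement of x and at y and its complement decomposes the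
   clauses without the complement of x into two parts sharing only the variables
   of x and y; a (1,1)-variable in either part clashes in the two clauses of the
   complement of x. As clashes are unique, one of the parts is a single binary
   clause. Therefore F consists of a clause L, its complement, and binary
   clauses {x, -tau x} for x in L, where tau is a cyclic permutation of L; such
   an F is determined up to isomorphism by its number of variables. *)
Require Import Defs.
From mathcomp Require Import all_boot.
From mathcomp Require Import finmap.
From mathcomp Require Import zify.
From Stdlib Require Import Classical.
Set Implicit Arguments. Unset Strict Implicit. Unset Printing Implicit Defensive.
Local Open Scope fset_scope.
Local Open Scope nat_scope.

Implicit Types (V : {fset nat}) (C D E : clause) (F G J S T U : clauseset) (x y l : lit).

(** * Literals, complements and variable sets *)

Lemma complK x : compl (compl x) = x.
Proof. by case: x => v b; rewrite /compl /= negbK. Qed.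

Lemma compl_neq x : compl x != x.
Proof. by case: x => v []; rewrite /compl xpair_eqE /= andbF. Qed.

Lemma eq_compl x y : (compl x == y) = (x == compl y).
Proof. by apply/eqP/eqP => [<-|->]; rewrite complK. Qed.

Lemma lit_var_eq x y : x.1 = y.1 -> (x == y) || (x == compl y).
Proof.
case: x y => v b [w c] /= ->; rewrite /compl !xpair_eqE eqxx /=.
by case: b; case: c.
Qed.

Lemma eval_compl (f : nat -> bool) x : (f (compl x).1 == (compl x).2) = (f x.1 != x.2).
Proof. by case: x => v b /=; case: (f v); case: b. Qed.

Lemma mem_varC C l : l \in C -> l.1 \in varC C.
Proof. by move=> lC; apply/imfsetP; exists l. Qed.

Lemma varCP C u : reflect (exists2 l, l \in C & l.1 = u) (u \in varC C).
Proof.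
by apply: (iffP (imfsetP _ _ _ _)) => /= [[l lC ->]|[l lC <-]]; exists l.
Qed.

Lemma varFP F u :
  reflect (exists2 C, C \in F & exists2 l, l \in C & l.1 = u) (u \in varF F).
Proof.
apply: (iffP (bigfcupP _ _ _ _)) => [[C]|[C CF /varCP uC]].
  by rewrite andbT => CF /varCP; exists C.
by exists C; rewrite ?CF.
Qed.

Lemma mem_varF F C l : C \in F -> l \in C -> l.1 \in varF F.
Proof. by move=> CF lC; apply/varFP; exists C => //; exists l. Qed.

Lemma varFS F G : F `<=` G -> varF F `<=` varF G.
Proof.
move=> /fsubsetP FG; apply/fsubsetP => u /varFP [C /FG CG [l lC <-]].
exact: mem_varF lC.
Qed.

Lemma varFU F G : varF (F `|` G) = varF F `|` varF G.
Proof.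
apply/fsetP => u; rewrite inE; apply/varFP/orP.
  by case=> C; rewrite inE => /orP [] CF [l lC <-]; [left|right]; apply: mem_varF lC.
by case=> /varFP [C CF h]; exists C => //; rewrite inE CF ?orbT.
Qed.

(** * Clause-sets relative to deleted variables *)

(* Clause-sets are studied relative to a set [V] of deleted variables: a clause
   stands for its restriction to the variables outside [V], so that
   restrictions of distinct clauses are still counted separately. *)
Definition rsat V F : Prop :=
  exists f : nat -> bool, forall C, C \in F ->
    exists2 l, l \in C & (l.1 \notin V) && (f l.1 == l.2).

Definition rMU V F : Prop := ~ rsat V F /\ forall C, C \in F -> rsat V (F `\ C).

Definition rnv V F : nat := #|` varF F `\` V|.

Lemma rsat_sub V F G : F `<=` G -> rsat V G -> rsat V F.
Proof. by move=> /fsubsetP FG [f fG]; exists f => C /FG; apply: fG. Qed.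

Lemma rsat0 V : rsat V fset0.
Proof. by exists xpredT. Qed.

Lemma rMU_neq0 V F : rMU V F -> F != fset0.
Proof. by case=> nF _; apply/eqP => F0; apply: nF; rewrite F0; apply: rsat0. Qed.

Lemma rMU_proper V F J : rMU V F -> J `<` F -> rsat V J.
Proof.
move=> [_ mF]; rewrite fproperE => /andP [JF /fsubsetPn [C CF CJ]].
by apply: rsat_sub (mF C CF); rewrite fsubsetD1 JF.
Qed.

Lemma rMU_eq V F T : rMU V F -> T `<=` F -> ~ rsat V T -> T = F.
Proof.
move=> mF TF nT; apply/eqP; case: eqVneq => // neq.
by case: nT; apply: (rMU_proper mF); rewrite fproperEneq neq.
Qed.

(** The combined assignment follows [g] on [W]; clauses of [T] are satisfied off [W], so the
    overwriting does not harm them. *)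
Lemma rsat_glue V W J T (g : nat -> bool) :
  (forall C, C \in J -> exists2 l, l \in C & [&& l.1 \in W, l.1 \notin V & g l.1 == l.2]) ->
  rsat (V `|` W) T -> rsat V (J `|` T).
Proof.
move=> gJ [f fT]; exists (fun u => if u \in W then g u else f u) => C.
rewrite inE; case: (boolP (C \in J)) => [CJ _|_ /= /fT [l lC]].
  by have [l lC /and3P [lW lV h]] := gJ C CJ; exists l; rewrite //= lW lV.
by rewrite inE negb_or => /andP [/andP [lV lW] h]; exists l; rewrite //= lV (negbTE lW).
Qed.

Lemma rsatU V J T : rsat V J -> rsat (V `|` varF J) T -> rsat V (J `|` T).
Proof.
move=> [g gJ]; apply: (rsat_glue (g := g)) => C CJ.
by have [l lC h] := gJ C CJ; exists l; rewrite // (mem_varF CJ lC).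
Qed.

Lemma rMU_core V F : ~ rsat V F -> exists2 T, T `<=` F & rMU V T.
Proof.
have [k] := ubnP #|`F|; elim: k F => // k IH F; rewrite ltnS => leF nF.
case: (classic (rMU V F)) => [mF|nmF]; first by exists F.
have [C [CF nC]] : exists C, C \in F /\ ~ rsat V (F `\ C).
  by apply: NNPP => h; apply: nmF; split=> // C CF; apply: NNPP => nC; apply: h; exists C.
have := IH (F `\ C); rewrite (cardfsD1 C F) CF in leF.
by move=> /(_ leF nC) [T TF mT]; exists T => //; apply: fsubset_trans TF (fsubD1set _ _).
Qed.

Lemma rnvS V S T : S `<=` T -> rnv V S <= rnv V T.
Proof. by move=> ST; apply: fsubset_leq_card; apply/fsetSD/varFS. Qed.

Lemma rnvU V J T : rnv V (J `|` T) = rnv V J + rnv (V `|` varF J) T.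
Proof.
rewrite /rnv -cardfsUI; set A := _ `&` _.
have -> : A = fset0.
  by apply/fsetP => u; rewrite !inE; case: (u \in V) (u \in varF J) (u \in varF T) => [] [] [].
rewrite cardfs0 addn0 varFU; congr #|` _|.
by apply/fsetP => u; rewrite !inE; case: (u \in V) (u \in varF J) (u \in varF T) => [] [] [].
Qed.

Lemma rnv_dead V W T : rnv V T <= rnv (V `|` W) T + #|`W|.
Proof.
apply: leq_trans (_ : #|` (varF T `\` (V `|` W)) `|` W| <= _).
  apply: fsubset_leq_card; apply/fsubsetP => u; rewrite !inE.
  by case: (u \in V) (u \in W) (u \in varF T) => [] [] [].
by rewrite cardfsU leq_subr.
Qed.

Lemma rnv0 F : rnv fset0 F = nvars F.
Proof. by rewrite /rnv fsetD0. Qed.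

(** * Hall's theorem, deficiency of subsets, and quotients *)

Lemma card_fsetU_disj (A B : clauseset) : [disjoint A & B]%fset ->
  #|` A `|` B| = #|`A| + #|`B|.
Proof. by rewrite -fsetI_eq0 -cardfsUI => /eqP ->; rewrite cardfs0 addn0. Qed.

Lemma disjointDl S A B : S `<=` A `\` B -> [disjoint B & S]%fset.
Proof. by rewrite fsubsetD fdisjoint_sym => /andP []. Qed.

Lemma fsetU_compl (S T : clauseset) : S `<=` T -> S `|` (T `\` S) = T.
Proof.
move=> /fsubsetP ST; apply/fsetP => C; rewrite !inE.
by case: (boolP (C \in S)) => [/ST|].
Qed.

(* Hall's marriage theorem: the clauses have distinct representative variables. *)
Lemma hall_sat V T : (forall S, S `<=` T -> #|`S| <= rnv V S) -> rsat V T.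
Proof.
have [k] := ubnP #|`T|; elim: k T V => // k IH T V; rewrite ltnS => leT hT.
have [->|/fset0Pn [C CT]] := eqVneq T fset0; first exact: rsat0.
(* A tight proper subset and the remaining clauses, with its variables deleted, satisfy Hall's
   condition separately. *)
case: (classic (exists S, [/\ S `<` T, S != fset0 & #|`S| = rnv V S])).
  case=> S [ST S0 cS].
  have sST : S `<=` T by apply: fproper_sub.
  have ltS := fproper_ltn_card ST.
  have posS : 0 < #|`S| by rewrite cardfs_gt0.
  have cTS := cardfsDS sST.
  have -> : T = S `|` (T `\` S) by rewrite fsetU_compl.
  apply: rsatU; apply: IH; first by lia.
  - by move=> S' S'S; apply/hT/(fsubset_trans S'S).
  - by lia.
  move=> S' S'T; have := hT (S `|` S'); rewrite rnvU card_fsetU_disj; last exact: disjointDl S'T.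
  have sub : S `|` S' `<=` T by rewrite fsubUset sST (fsubset_trans S'T) ?fsubsetDl.
  by move=> /(_ sub); lia.
(* Without tight subsets every smaller nonempty subset has a spare variable, so [C] can claim one
   and the rest still satisfies the condition. *)
move=> nS.
have posC : 0 < rnv V [fset C] by have := hT [fset C]; rewrite fsub1set cardfs1; apply.
have [u] : exists u, u \in varF [fset C] `\` V by apply/fset0Pn; rewrite -cardfs_gt0.
rewrite inE => /andP [uV /varFP [D]]; rewrite inE => /eqP -> [l lC lu].
have [f fT] : rsat (V `|` [fset u]) (T `\ C).
  apply: IH; first by rewrite (cardfsD1 C T) CT in leT.
  move=> S; rewrite fsubsetD1 => /andP [ST CS].
  have [->|S0] := eqVneq S fset0; first by rewrite cardfs0.
  have hS := hT S ST; have := rnv_dead V [fset u] S; rewrite cardfs1.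
  suff : #|`S| != rnv V S by lia.
  apply: contra_notN nS => /eqP cS; exists S; split=> //.
  by rewrite fproperE ST; apply/fsubsetPn; exists C.
exists (fun v => if v == u then l.2 else f v) => E ET.
have [->|EC] := eqVneq E C; first by exists l; rewrite //= lu uV !eqxx.
have [|l' l'E] := fT E; first by rewrite !inE EC.
rewrite !inE negb_or => /andP [/andP [l'V l'u] h].
by exists l'; rewrite //= l'V (negbTE l'u).
Qed.

(** Take a largest counterexample [J]. No set of further clauses raises its deficiency, so Hall's
    theorem satisfies the rest over the new variables, and with it all of [F]. *)
Lemma tarsi V F J : rMU V F -> J `<` F -> #|`J| + rnv V F < #|`F| + rnv V J.
Proof.
move=> mF; have [k] := ubnP #|`F `\` J|; elim: k J => // k IH J; rewrite ltnS => leJ JF.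
have sJF := fproper_sub JF; rewrite ltnNge; apply/negP => bad.
have cFJ := cardfsDS sJF; have ltJ := fproper_ltn_card JF.
have hS : forall S, S `<=` F `\` J -> #|`S| <= rnv (V `|` varF J) S.
  move=> S SFJ; rewrite leqNgt; apply/negP => ltS.
  have cJS : #|`J `|` S| = #|`J| + #|`S| by rewrite card_fsetU_disj //; apply: disjointDl SFJ.
  have JSF : J `|` S `<=` F by rewrite fsubUset sJF (fsubset_trans SFJ) ?fsubsetDl.
  have [eqF|neF] := eqVneq (J `|` S) F.
    by move: bad; rewrite -eqF rnvU; lia.
  have pJS : J `|` S `<` F by rewrite fproperEneq neF.
  have := IH _ _ pJS; rewrite rnvU; have := cardfsDS JSF; have := fproper_ltn_card pJS.
  by lia.
have := rsatU (rMU_proper mF JF) (hall_sat hS); rewrite fsetU_compl //.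
by case: mF.
Qed.

Lemma rMU_deficiency V F : rMU V F -> rnv V F < #|`F|.
Proof.
move=> mF; have := @tarsi V F fset0 mF; rewrite fproper0 (rMU_neq0 mF) cardfs0 => /(_ isT).
suff -> : rnv V fset0 = 0 by lia.
by rewrite /rnv /varF big_nil fset0D cardfs0.
Qed.

(** [T] is a core of the clauses that [rho] does not satisfy on [V'] outside [V]; satisfying these
    off [V'] and using [rho] on [V'] would satisfy [F]. *)
Lemma rMU_cut V V' F (rho : nat -> bool) : ~ rsat V F -> V `<=` V' ->
  exists T, [/\ T `<=` F, rMU V' T &
    forall C l, C \in T -> l \in C -> l.1 \in V' -> l.1 \notin V -> rho l.1 != l.2].
Proof.
move=> nF /fsubsetP VV'.
pose alive C := [forall l : C, ((val l).1 \in V') ==> ((val l).1 \notin V) ==>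
                               (rho (val l).1 != (val l).2)].
have [|T TG mT] := @rMU_core V' [fset C in F | alive C].
  case=> f fG; apply: nF; exists (fun u => if u \in V' then rho u else f u) => C CF.
  case: (boolP (alive C)) => [aC|/forallPn [l]].
    have [|l lC /andP [lV' h]] := fG C; first by rewrite !inE CF.
    by exists l; rewrite // (negbTE lV') h (contra (VV' _)).
  rewrite negb_imply => /andP [lV']; rewrite negb_imply => /andP [lV /negPn h].
  by exists (val l); [apply: fsvalP | rewrite lV lV'; apply: h].
exists T; split=> //; first by apply: fsubset_trans TG _; apply/fsubsetP => C; rewrite !inE => /andP [].
move=> C l CT lC lV' lV; have := fsubsetP TG C CT; rewrite !inE => /andP [_ /forallP].
by move=> /(_ [`lC]) /=; rewrite lV' lV.
Qed.

(** Cutting by an assignment that satisfies [J] discards every clause of [J]. *)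
Lemma rMU_quotient V F J : rMU V F -> J `<` F ->
  exists2 T, T `<=` F `\` J & rMU (V `|` varF J) T.
Proof.
move=> mF JF; have [g gJ] := rMU_proper mF JF.
have [T [TF mT hT]] := rMU_cut g mF.1 (fsubsetUl V (varF J)).
exists T => //; rewrite fsubsetD TF -fsetI_eq0; apply/eqP/fsetP => C; rewrite in_fset0 inE.
apply/negP => /andP [CT CJ]; have [l lC /andP [lV h]] := gJ C CJ.
by have := hT C l CT lC; rewrite inE (mem_varF CJ lC) orbT lV h => /(_ isT isT).
Qed.

(** * Literal degrees, splitting, and deficiency 1 *)

Definition occ F x : clauseset := [fset C in F | x \in C].

Lemma occE F x C : (C \in occ F x) = (C \in F) && (x \in C).
Proof. by rewrite !inE. Qed.

Lemma ldeg_gt0P F x : reflect (exists2 C, C \in F & x \in C) (0 < ldeg F x).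
Proof.
rewrite cardfs_gt0; apply: (iffP (fset0Pn _)) => [[C]|[C CF xC]].
  by rewrite !inE => /andP [CF xC]; exists C.
by exists C; rewrite !inE CF.
Qed.

Lemma ldegS S T x : S `<=` T -> ldeg S x <= ldeg T x.
Proof.
move=> /fsubsetP ST; apply: fsubset_leq_card; apply/fsubsetP => C.
by rewrite !inE => /andP [/ST -> ->].
Qed.

Lemma ldegU S T x : ldeg (S `|` T) x <= ldeg S x + ldeg T x.
Proof.
rewrite -cardfsUI; apply: leq_trans (leq_addr _ _); apply: fsubset_leq_card.
by apply/fsubsetP => C; rewrite !inE andb_orl.
Qed.

Lemma ldeg1 C x : ldeg [fset C] x = (x \in C).
Proof.
case: (boolP (x \in C)) => xC /=.
  rewrite -(cardfs1 C); congr #|` _|; apply/fsetP => D; rewrite !inE.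
  by case: eqP => // ->.
apply/eqP; rewrite cardfs_eq0; apply/eqP/fsetP => D; rewrite !inE.
by case: eqP => // ->; rewrite (negbTE xC).
Qed.

Lemma ldeg_notin F x : x.1 \notin varF F -> ldeg F x = 0.
Proof.
move=> xF; apply/eqP; rewrite -leqn0 leqNgt; apply: contra xF => /ldeg_gt0P [C CF xC].
exact: mem_varF xC.
Qed.

(** Otherwise [compl x] is pure: making it true restores the removed clause [C] and harms no other
    clause. *)
Lemma rMU_ldeg_gt0 V F x : rMU V F -> x.1 \in varF F -> x.1 \notin V -> 0 < ldeg F x.
Proof.
move=> [nF mF] /varFP [C CF [l lC lx]] xV; case: posnP => // /eqP; rewrite cardfs_eq0 => /eqP d0.
have xN D : D \in F -> x \notin D.
  by move=> DF; apply/negP => xD; have := in_fset0 D; rewrite -d0 !inE DF xD.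
have [f fC] := mF C CF; case: nF.
exists (fun u => if u == x.1 then ~~ x.2 else f u) => D DF.
have [xD|xD] := boolP (compl x \in D).
  by exists (compl x); rewrite //= xV !eqxx.
have [eqD|neD] := eqVneq D C.
  have := lit_var_eq lx; case/orP => /eqP el; first by case/negP: (xN C CF); rewrite -el.
  by case/negP: xD; rewrite eqD -el.
have [|k kD kV] := fC D; first by rewrite !inE neD.
exists k => //=; case: (k.1 =P x.1) => // kx; have := lit_var_eq kx; case/orP => /eqP ek.
  by case/negP: (xN D DF); rewrite -ek.
by case/negP: xD; rewrite -ek.
Qed.

(** Making [x] true leaves a core of positive deficiency with the variable of [x] deleted; putting
    that variable back costs at most one. Without it, the core would be a proper subset
    unsatisfiable over [V]. *)
Lemma rMU_split V F x : rMU V F -> x.1 \notin V -> x.1 \in varF F ->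
  exists T, [/\ T `<` F, rMU (V `|` [fset x.1]) T, x.1 \in varF T,
                rnv V T <= #|`T| & forall C, C \in T -> x \notin C].
Proof.
move=> mF xV xF.
have [T [TF mT hT]] := rMU_cut (fun=> x.2) mF.1 (fsubsetUl V [fset x.1]).
have xT C : C \in T -> x \notin C.
  move=> CT; apply/negP => xC; have := hT C x CT xC.
  by rewrite !inE eqxx orbT xV eqxx => /(_ isT isT).
have pT : T `<` F.
  rewrite fproperE TF; apply/fsubsetPn.
  have /ldeg_gt0P [C CF xC] := rMU_ldeg_gt0 mF xF xV.
  by exists C => //; apply/negP => /xT; rewrite xC.
have dT := leq_trans (rnv_dead V [fset x.1] T) _; rewrite cardfs1 addn1 in dT.
exists T; split=> //; last exact: dT (rMU_deficiency mT).
apply: contraT => xvT; case: mT => nT _; case: nT.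
have [f fT] := rMU_proper mF pT; exists f => C CT; have [l lC /andP [lV h]] := fT C CT.
exists l => //; rewrite h !inE negb_or lV andbT /=; apply: contra xvT => /eqP <-.
exact: mem_varF lC.
Qed.

(* The unsatisfiable core [T] left by a split at a variable has deficiency 0;
   either the quotient by it is a smaller instance, or it misses a single clause. *)
Lemma rMU1_singular V F : rMU V F -> #|`F| = (rnv V F).+1 -> 0 < rnv V F ->
  exists2 z, z \in varF F `\` V & forall b, ldeg F (z, b) = 1.
Proof.
have [k] := ubnP (rnv V F); elim: k V F => // k IH V F; rewrite ltnS => leF mF cF posF.
have [z zFV] : exists z, z \in varF F `\` V by apply/fset0Pn; rewrite -cardfs_gt0.
have /andP [zV zF] : (z \notin V) && (z \in varF F) by rewrite -in_fsetD.
suff [h|h] : (exists2 z, z \in varF F `\` V & forall b, ldeg F (z, b) = 1) \/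
             forall b, ldeg F (z, b) = 1 by [|exists z].
apply: NNPP => nh; apply: (nh); right => b; apply: NNPP => nb.
have [T [TF _ zT dT xT]] := rMU_split (x := (z, b)) mF zV zF.
have sTF := fproper_sub TF; have cFT := cardfsDS sTF; have tT := tarsi mF TF.
have posT : 0 < rnv V T by rewrite cardfs_gt0; apply/fset0Pn; exists z; rewrite inE zV.
(* [T] has deficiency exactly 0. If it has as many variables as [F], it omits a single clause, the
   only one containing [(z, b)]. *)
have [eqT|neT] := eqVneq (rnv V T) (rnv V F).
  apply: nb; apply/eqP; rewrite eqn_leq (rMU_ldeg_gt0 (x := (z, b)) mF zF zV) andbT.
  suff : ldeg F (z, b) <= #|`F `\` T| by lia.
  apply: fsubset_leq_card; apply/fsubsetP => C; rewrite !inE => /andP [-> xC].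
  by rewrite andbT; apply/negP => /xT; rewrite xC.
have [H HF mH] := rMU_quotient mF TF; have dH := rMU_deficiency mH.
have cTH := card_fsetU_disj (disjointDl HF).
(* [T] and [H] together have deficiency at least 1, so they exhaust [F]; a (1,1)-variable of [H]
   avoids [T] and keeps its degrees in [F]. *)
have eqF : T `|` H = F.
  apply/eqP; apply: contraT => neF.
  have pTH : T `|` H `<` F.
    by rewrite fproperEneq neF fsubUset sTF (fsubset_trans HF) ?fsubsetDl.
  by have := tarsi mF pTH; rewrite rnvU; move: cTH tT dH dT cF; clear; lia.
have nTH := rnvU V T H; rewrite eqF in nTH; rewrite eqF in cTH.
have leT := rnvS V sTF.
have [|||u] := IH _ H _ mH; [lia | lia | lia | ].
rewrite !inE negb_or -andbA => /and3P [uV uT uH] du.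
apply: nh; left; exists u; first by rewrite inE uV (fsubsetP (varFS _) _ uH) // -eqF fsubsetUr.
move=> c; apply/eqP; rewrite eqn_leq -{2}(du c) ldegS -?eqF ?fsubsetUr // andbT.
by apply: leq_trans (ldegU _ _ _) _; rewrite ldeg_notin // du.
Qed.

Lemma tarsi0 F J : rMU fset0 F -> J `<` F -> #|`J| + nvars F < #|`F| + nvars J.
Proof. by move=> mF; rewrite -!rnv0; apply: tarsi. Qed.

Lemma nvarsU J T : nvars (J `|` T) = nvars J + rnv (varF J) T.
Proof. by rewrite -!rnv0 rnvU fset0U. Qed.

Lemma rMU_quotient0 F J : rMU fset0 F -> J `<` F ->
  exists T, [/\ T `<=` F `\` J, rMU (varF J) T & rnv (varF J) T < #|`T|].
Proof.
move=> mF JF; have [T TF] := rMU_quotient mF JF; rewrite fset0U => mT.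
by exists T; split=> //; apply: rMU_deficiency mT.
Qed.

(** * Nonsingular clause-sets of deficiency 2 *)

(** The degree bound expresses nonsingularity, since in a minimally unsatisfiable clause-set both
    literals of each variable occur. *)
Definition nonsingular2 F : Prop :=
  [/\ rMU fset0 F, is_clauseset F, #|`F| = nvars F + 2 &
      forall x, x.1 \in varF F -> 1 < ldeg F x].

(* By [rMU1_singular], a quotient of deficiency 1 with variables left contains a
   variable of degrees (1,1), which can only be nonsingular in [F] thanks to
   clauses outside the quotient. *)
Lemma deficiency1_subset F T : nonsingular2 F -> T `<` F -> nvars T < #|`T| ->
  #|`F `\` T| = 1.
Proof.
case=> mF cF eF dF TF ltT; have sTF := fproper_sub TF.
have [H [HF mH dH]] := rMU_quotient0 mF TF.
have cTH := card_fsetU_disj (disjointDl HF); have nTH := nvarsU T H.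
have tT := tarsi0 mF TF.
have eqF : T `|` H = F.
  apply/eqP; apply: contraT => neF.
  have pTH : T `|` H `<` F.
    by rewrite fproperEneq neF fsubUset sTF (fsubset_trans HF) ?fsubsetDl.
  by have := tarsi0 mF pTH; lia.
rewrite eqF in cTH nTH; have cFT := cardfsDS sTF.
suff : rnv (varF T) H = 0 by lia.
apply/eqP; rewrite -leqn0 leqNgt; apply/negP => posH.
have [|z] := rMU1_singular mH _ posH; first by lia.
rewrite inE => /andP [zT zH] dz.
have zF : (z, true).1 \in varF F by rewrite -eqF varFU inE zH orbT.
have := dF _ zF; rewrite -eqF; have := ldegU T H (z, true).
by rewrite dz (ldeg_notin (F := T)) //; lia.
Qed.

(** If [J] and its quotient [H] miss a clause [C], a (1,1)-variable of [H] would need both its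
    literals in [C]. Otherwise [H] is condensed into one clause [E], and a core of [E] with [J]
    yields a smaller instance or a literal of degree 1. *)
Lemma deficiency0_subset F J : nonsingular2 F -> J `<` F -> J != fset0 ->
  nvars J <= #|`J| -> #|`F `\` J| <= 2.
Proof.
move=> nsF; have [k] := ubnP #|`J|; elim: k J => // k IH J; rewrite ltnS => leJ JF J0 dJ.
have [mF cF eF dF] := nsF; have sJF := fproper_sub JF.
have cFJ := cardfsDS sJF; have tJ := tarsi0 mF JF.
have [ltJ|geJ] := ltnP (nvars J) #|`J|; first by rewrite (deficiency1_subset nsF).
have [H [HF mH dH]] := rMU_quotient0 mF JF.
have cJH := card_fsetU_disj (disjointDl HF); have nJH := nvarsU J H.
have sJH : J `|` H `<=` F by rewrite fsubUset sJF (fsubset_trans HF) ?fsubsetDl.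
have [eqF|neF] := eqVneq (J `|` H) F; last first.
  have pJH : J `|` H `<` F by rewrite fproperEneq neF.
  have ltJH : nvars (J `|` H) < #|`J `|` H| by lia.
  have c1 := deficiency1_subset nsF pJH ltJH; have tJH := tarsi0 mF pJH.
  have cFJH := cardfsDS sJH.
  suff : rnv (varF J) H = 0 by lia.
  apply/eqP; rewrite -leqn0 leqNgt; apply/negP => posH.
  have [|z] := rMU1_singular mH _ posH; first by lia.
  rewrite inE => /andP [zJ zH] dz.
  have /eqP/cardfs1P [C eqC] := c1.
  have zC b : (z, b) \in C.
    have : 1 < ldeg F (z, b).
      by apply: dF; apply: (fsubsetP (varFS sJH)); rewrite varFU inE zH orbT.
    rewrite -(fsetU_compl sJH) eqC; apply: contraTT => zC.
    have := ldegU (J `|` H) [fset C] (z, b); have := ldegU J H (z, b).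
    by rewrite ldeg1 (negbTE zC) dz (ldeg_notin (F := J)) //; clear; lia.
  have CF : C \in F by have : C \in [fset C] by [rewrite inE]; rewrite -eqC inE => /andP [].
  by have := cF C CF _ (zC true); rewrite (zC false).
have disJH : [disjoint J & H]%fset by apply: disjointDl HF.
have satJ : rsat fset0 J := rMU_proper mF JF.
(* [E] gathers the literals of [H] over the variables of [J], possibly complementary ones.
   Satisfying [J] and [E] satisfies one clause of [H]; by minimality the others are satisfiable over
   the remaining variables. *)
pose E : clause := [fset l in \bigcup_(C <- H) C | l.1 \in varF J].
have inE_ C l : C \in H -> l \in C -> l.1 \in varF J -> l \in E.
  by move=> CH lC lJ; rewrite !inE lJ andbT; apply/bigfcupP; exists C; rewrite ?CH.
have EP l : l \in E -> l.1 \in varF J /\ exists2 C, C \in H & l \in C.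
  by rewrite !inE => /andP [/bigfcupP [C /andP [CH _] lC] ->]; split=> //; exists C.
have unsatE : ~ rsat fset0 (E |` J).
  case=> g gE; have [|l lE /andP [_ gl]] := gE E; first by rewrite !inE eqxx.
  have [lJ [C CH lC]] := EP l lE; case: mF => nF _; case: nF.
  rewrite -eqF (_ : J `|` H = (C |` J) `|` (H `\ C)).
    apply: (rsat_glue (W := varF J) (g := g)); last by rewrite fset0U; apply: mH.2.
    move=> D; rewrite !inE => /orP [/eqP ->|DJ]; first by exists l; rewrite // lJ.
    have [|m mD mg] := gE D; first by rewrite !inE DJ orbT.
    by exists m; rewrite // (mem_varF DJ).
  apply/fsetP => D; rewrite !inE; case: eqP => [->|_] /=; first by rewrite CH !orbT.
  by [].
have [K KE mK] := rMU_core unsatE; have dK := rMU_deficiency mK; rewrite rnv0 in dK.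
have EK : E \in K.
  apply: contraT => EK; case: mK => nK _; case: nK; apply: rsat_sub satJ.
  by apply/fsubsetP => D DK; move: (fsubsetP KE D DK); rewrite !inE; case: eqP DK EK => // -> ->.
have cK := cardfsD1 E K; rewrite EK in cK.
have leK : nvars (K `\ E) <= nvars K by rewrite -!rnv0; apply/rnvS/fsubD1set.
have J0J : K `\ E `<=` J by rewrite fsubDset.
(* A core consisting of [E] alone would make [E] empty, hence [H] unsatisfiable by itself and equal
   to [F]. *)
have J00 : K `\ E != fset0.
  apply/eqP => K0; have [E0|/fset0Pn [l lE]] := eqVneq E fset0.
    have nH : ~ rsat fset0 H.
      move=> [f fH]; case: mH => nH _; apply: nH; exists f => C CH.
      have [l lC h] := fH C CH; exists l => //; case/andP: h => _ ->; rewrite andbT.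
      by apply/negP => /(inE_ C l CH lC); rewrite E0 in_fset0.
    have HF' : H `<=` F by rewrite -eqF fsubsetUr.
    move: disJH; rewrite (rMU_eq mF HF' nH) -fsetI_eq0 (fsetIidPl sJF).
    by rewrite (negbTE J0).
  case: mK => nK _; apply: nK; exists (fun=> l.2) => D DK; exists l; rewrite ?eqxx ?in_fset0 //.
  suff -> : D = E by [].
  by apply/eqP; apply: contraT => DE; have := in_fset0 D; rewrite -K0 !inE DE DK.
have [eqJ|neJ] := eqVneq (K `\ E) J; last first.
  have pJ : K `\ E `<` J by rewrite fproperEneq neJ.
  have ltJ := fproper_ltn_card pJ.
  have pF := fproper_sub_trans pJ sJF.
  have le0 : nvars (K `\ E) <= #|`K `\ E| by move: cK dK leK; clear; lia.
  have := IH (K `\ E) (leq_trans ltJ leJ) pF J00 le0.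
  by rewrite (cardfsDS (fproper_sub pF)) cFJ; move: ltJ; clear; lia.
rewrite eqJ in cK leK.
(* Now [K] has deficiency 1 and a (1,1)-variable [z]. Some literal of [z] is missing from [E], which
   would otherwise always be true; it does not occur in [H], so its degree in [F] is at most 1. *)
have posJ : 0 < #|`J| by rewrite cardfs_gt0.
have [||z] := rMU1_singular mK; rewrite ?rnv0.
- by move: cK dK leK dJ geJ; clear; lia.
- by move: leK posJ geJ; clear; lia.
rewrite fsetD0 => zK dz.
have zJ : z \in varF J.
  case/varFP: zK => D DK [l lD <-]; have := fsubsetP KE D DK; rewrite !inE.
  by case: eqP lD => [-> lE _|_ lD DJ]; [case: (EP l lE) | apply: mem_varF lD].
have [b zE] : exists b, (z, b) \notin E.
  apply: NNPP => nb; apply: unsatE; have [g gJ] := satJ; exists g => D.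
  rewrite !inE => /orP [/eqP ->|]; last exact: gJ.
  exists (z, g z); rewrite ?in_fset0 ?eqxx //.
  by apply: contraT => zE; case: nb; exists (g z).
have := dF (z, b) (fsubsetP (varFS sJF) _ zJ); have := ldegU J H (z, b); rewrite eqF.
have : ldeg J (z, b) <= ldeg K (z, b) by rewrite ldegS // -eqJ fsubD1set.
suff -> : ldeg H (z, b) = 0 by rewrite dz; clear; lia.
apply/eqP; rewrite -leqn0 leqNgt; apply: contra zE => /ldeg_gt0P [C CH zC].
exact: inE_ CH zC zJ.
Qed.

(** * Splitting at a literal and clashing clauses *)

Lemma occ_sub F x : occ F x `<=` F.
Proof. by apply/fsubsetP => C; rewrite occE => /andP []. Qed.

(** The core left by making [x] true omits at most two clauses, and it omits all those containing
    [x], of which there are at least two. *)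
Lemma nonsingular2_cofactor F x : nonsingular2 F -> x.1 \in varF F ->
  [/\ ldeg F x = 2, rMU [fset x.1] (F `\` occ F x),
      #|`F `\` occ F x| = nvars F & nvars (F `\` occ F x) = nvars F].
Proof.
move=> nsF xF; have [mF cF eF dF] := nsF.
have [T [TF mT xT dT aT]] := rMU_split mF (negbT (in_fset0 x.1)) xF.
have sTF := fproper_sub TF; have cFT := cardfsDS sTF; rewrite rnv0 in dT.
have T0 : T != fset0 by apply: rMU_neq0 mT.
have c2 := deficiency0_subset nsF TF T0 dT; have d2 := dF x xF.
have subF : occ F x `<=` F `\` T.
  apply/fsubsetP => C; rewrite occE inE => /andP [-> xC]; rewrite andbT.
  by apply/negP => /aT; rewrite xC.
have lex : ldeg F x <= #|`F `\` T| := fsubset_leq_card subF.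
have eqo : occ F x = F `\` T.
  apply/eqP; rewrite eqEfcard subF /=.
  by apply: leq_trans c2 d2.
have eqT : F `\` occ F x = T by rewrite eqo fsetDK.
have leN : nvars T <= nvars F by rewrite -!rnv0 rnvS.
rewrite eqT; rewrite fset0U in mT.
have geT : #|`T| <= nvars T.
  by rewrite leqNgt; apply/negP => /(deficiency1_subset nsF TF); lia.
by split=> //; lia.
Qed.

Lemma nonsingular2_nvars F x : nonsingular2 F -> x.1 \in varF F -> 2 <= nvars F.
Proof.
move=> nsF xF; have [mF cF eF dF] := nsF.
suff : ldeg F x + ldeg F (compl x) <= #|`F|.
  by have := dF x xF; have := dF (compl x) xF; lia.
rewrite -[_ + _](@card_fsetU_disj (occ F x) (occ F (compl x))).
  by apply: fsubset_leq_card; rewrite fsubUset !occ_sub.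
rewrite -fsetI_eq0; apply/eqP/fsetP => C; rewrite in_fset0 in_fsetI !occE.
by apply/negP => /andP [/andP [CF xC] /andP [_]]; apply/negP/(cF C CF).
Qed.

Definition clash F x y E1 E2 : Prop :=
  [/\ occ F x = [fset E1; E2], E1 != E2, y.1 != x.1, y \in E1 & compl y \in E2].

Lemma clash_sym F x y E1 E2 : clash F x y E1 E2 -> clash F x (compl y) E2 E1.
Proof. by case=> e ne yx y1 y2; split; rewrite ?complK // 1?eq_sym // e fsetUC. Qed.

Lemma clashP F x y E1 E2 : clash F x y E1 E2 ->
  [/\ E1 \in F, E2 \in F, x \in E1 & x \in E2].
Proof.
case=> e _ _ _ _.
have : E1 \in occ F x by rewrite e !inE eqxx.
have : E2 \in occ F x by rewrite e !inE eqxx orbT.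
by rewrite !occE => /andP [-> ->] /andP [-> ->].
Qed.

Lemma clash_intro F x z : nonsingular2 F -> x.1 \in varF F -> z != x.1 ->
  (forall b, 0 < ldeg (occ F x) (z, b)) ->
  exists E1 E2, clash F x (z, true) E1 E2.
Proof.
move=> nsF xF zx h; have [mF cF eF dF] := nsF.
have /ldeg_gt0P [E1 o1 z1] := h true; have /ldeg_gt0P [E2 o2 z2] := h false.
have ne : E1 != E2.
  apply/eqP => e; move: o1; rewrite occE => /andP [E1F _].
  by have := cF E1 E1F _ z1; rewrite e z2.
exists E1, E2; split=> //; apply/eqP; rewrite eq_sym eqEfcard cardfs2 ne /=.
have [d2 _ _ _] := nonsingular2_cofactor nsF xF; rewrite -[#|`_|]/(ldeg F x) d2 leqnn andbT.
by apply/fsubsetP => C; rewrite !inE => /orP [] /eqP ->; rewrite -!occE.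
Qed.

Lemma nonsingular2_ldeg_occ F x z b : nonsingular2 F -> x.1 \in varF F -> z \in varF F ->
  ldeg (F `\` occ F x) (z, b) <= 1 -> 0 < ldeg (occ F x) (z, b).
Proof.
move=> nsF xF zF le1; have [d2 _ _ _] := nonsingular2_cofactor (x := (z, b)) nsF zF.
by have := ldegU (occ F x) (F `\` occ F x) (z, b); rewrite fsetU_compl ?occ_sub // d2; lia.
Qed.

(** Deleting the [x]-clauses and the variable of [x] leaves deficiency 1, hence a (1,1)-variable;
    its literals have degree 2 in [F], so both also occur in the [x]-clauses. *)
Lemma clash_exists F x : nonsingular2 F -> x.1 \in varF F ->
  exists y E1 E2, clash F x y E1 E2.
Proof.
move=> nsF xF; have [_ mN cN nN] := nonsingular2_cofactor nsF xF.
have n2 := nonsingular2_nvars nsF xF; have dN := rMU_deficiency mN.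
have := rnv_dead fset0 [fset x.1] (F `\` occ F x).
rewrite rnv0 nN fset0U cardfs1 => le.
have [||z] := rMU1_singular mN; [by lia | by lia | ].
rewrite !inE => /andP [zx zN] dz.
have zF : z \in varF F by apply: (fsubsetP (varFS _) _ zN); apply: fsubsetDl.
have [|E1 [E2 h]] := clash_intro (z := z) nsF xF zx; last by exists (z, true), E1, E2.
by move=> b; apply: nonsingular2_ldeg_occ; rewrite // dz.
Qed.

(** Making [x] and [y] true removes at least three clauses, so the core has negative deficiency;
    with the two variables deleted it is positive. Two variables change it by at most 2, so all
    bounds are attained. *)
Lemma nonsingular2_double_split F x y E : nonsingular2 F -> x.1 \in varF F ->
  y.1 != x.1 -> E \in F -> y \in E -> x \notin E ->
  exists T, [/\ T `<=` F, rMU [fset x.1; y.1] T, #|`T|.+1 = nvars T,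
    (rnv [fset x.1; y.1] T).+1 = #|`T| /\ [fset x.1; y.1] `<=` varF T &
    forall C, C \in T -> (x \notin C) && (y \notin C)].
Proof.
move=> nsF xF yx EF yE xE; have [mF cF eF dF] := nsF.
have [T [TF mT aT]] := rMU_cut (fun u => if u == x.1 then x.2 else y.2) mF.1
                               (fsub0set [fset x.1; y.1]).
have nT C : C \in T -> (x \notin C) && (y \notin C).
  move=> CT; apply/andP; split; apply/negP => lC; have := aT C _ CT lC.
    by rewrite !inE !eqxx => /(_ isT isT).
  by rewrite !inE eqxx orbT (negbTE yx) eqxx => /(_ isT isT).
pose V : {fset nat} := [fset x.1; y.1]; have {}mT : rMU V T := mT.
have T0 := rMU_neq0 mT; have dT := rMU_deficiency mT; have cFT := cardfsDS TF.
have [d2 _ _ _] := nonsingular2_cofactor nsF xF.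
have c3 : 3 <= #|`F `\` T|.
  have : E |` occ F x `<=` F `\` T.
    apply/fsubsetP => C; rewrite in_fset1U occE inE => /orP [/eqP ->|/andP [-> xC]].
      by rewrite EF andbT; apply/negP => /nT; rewrite yE andbF.
    by rewrite andbT; apply/negP => /nT; rewrite xC.
  by move=> /fsubset_leq_card; rewrite cardfsU1 occE EF (negbTE xE) -[#|`occ _ _|]/(ldeg F x) d2.
have pT : T `<` F by rewrite fproperEcard TF /= -subn_gt0 -cFT (leq_trans _ c3).
have ltT : #|`T| < nvars T.
  by rewrite ltnNge; apply/negP => /(deficiency0_subset nsF pT T0); lia.
have cV : #|`V| = 2 by rewrite cardfs2 eq_sym yx.
have subI : varF T `&` V `<=` V by apply: fsubsetIr.
have leI : #|`varF T `&` V| <= 2 by rewrite -cV; apply: fsubset_leq_card.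
have cI : #|`varF T `&` V| + rnv V T = nvars T := cardfsID V (varF T).
have eqI : varF T `&` V = V.
  by apply/eqP; rewrite eqEfcard subI cV andTb; move: ltT dT cI; clear; lia.
rewrite eqI cV in cI.
exists T; split=> //; first by move: ltT dT cI; clear; lia.
rewrite -/V; split; first by move: ltT dT cI; clear; lia.
by rewrite -eqI fsubsetIl.
Qed.

(** [T] and [U] are the cores for [x] false with [y] true and [y] false. Counting gives their common
    clauses deficiency at least 0, yet four clauses lie outside, so there are none. *)
Lemma clash_decomposition F x y E1 E2 : nonsingular2 F -> clash F x y E1 E2 ->
  let V := [fset x.1; y.1] in
  exists T U, [/\ T `|` U = F `\` occ F (compl x), #|`T| + #|`U| = nvars F,
    [/\ rMU V T, (rnv V T).+1 = #|`T| & E2 \in T],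
    [/\ rMU V U, (rnv V U).+1 = #|`U| & E1 \in U] &
    forall u, u \in varF T -> u \in varF U -> u \in V].
Proof.
move=> nsF cl V; have [mF cF eF dF] := nsF.
have [eo ne yx y1 y2] := cl; have [E1F E2F x1 x2] := clashP cl.
have xF : (compl x).1 \in varF F := mem_varF E1F x1.
have nx1 := cF _ E1F _ x1; have nx2 := cF _ E2F _ x2.
have [T [TF mT nT [rT /fsubsetP VT] aT]] := nonsingular2_double_split nsF xF yx E1F y1 nx1.
have [U [UF mU nU [rU /fsubsetP VU] aU]] :=
  nonsingular2_double_split (y := compl y) nsF xF yx E2F y2 nx2.
rewrite -/V in mT rT mU rU; have [d2 mN cN nN] := nonsingular2_cofactor nsF xF.
have TUN : T `|` U `<=` F `\` occ F (compl x).
  apply/fsubsetP => C; rewrite in_fsetU in_fsetD occE.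
  by case/orP => [CT|CU]; [have := aT C CT; rewrite (fsubsetP TF) |
    have := aU C CU; rewrite (fsubsetP UF)] => // /andP [/negbTE ->].
have eqN : T `|` U = F `\` occ F (compl x).
  apply: rMU_eq mN TUN _ => -[f fTU].
  have [fy|fy] := boolP (f y.1 == y.2).
    case: mT => nT' _; apply: nT'; exists f => C CT.
    have [|l lC] := fTU C; first by rewrite inE CT.
    rewrite !inE => /andP [lx lf]; exists l; rewrite // !inE (negbTE lx) lf andbT /=.
    apply/eqP => ly; case/orP: (lit_var_eq ly) => /eqP e.
      by have := aT C CT; rewrite -e lC andbF.
    by move: lf; rewrite e eval_compl fy.
  case: mU => nU' _; apply: nU'; exists f => C CU.
  have [|l lC] := fTU C; first by rewrite inE CU orbT.
  rewrite !inE => /andP [lx lf]; exists l; rewrite // !inE (negbTE lx) lf andbT /=.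
  apply/eqP => ly; case/orP: (lit_var_eq ly) => /eqP e.
    by move: lf; rewrite e (negbTE fy).
  by have := aU C CU; rewrite -e lC andbF.
have E1T : E1 \notin T by apply/negP => /aT; rewrite y1 andbF.
have E2U : E2 \notin U by apply/negP => /aU; rewrite y2 andbF.
have E1TU : E1 \in T `|` U by rewrite eqN in_fsetD occE E1F nx1.
have E2TU : E2 \in T `|` U by rewrite eqN in_fsetD occE E2F nx2.
move: E1TU E2TU; rewrite !inE (negbTE E1T) (negbTE E2U) /= orbF => E1U E2T.
have cTU : nvars F + #|`T `&` U| = #|`T| + #|`U| by rewrite -cN -eqN cardfsUI.
have cv : nvars F + #|`varF T `&` varF U| = nvars T + nvars U.
  by rewrite -nN -eqN /nvars varFU cardfsUI.
have cV : #|`V| = 2 by rewrite cardfs2 eq_sym yx.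
have subI : V `|` varF (T `&` U) `<=` varF T `&` varF U.
  rewrite fsubUset !fsubsetI !varFS ?fsubsetIl ?fsubsetIr // !andbT.
  by apply/andP; split; apply/fsubsetP.
(* [x] occurs only in [E1] and [E2], neither of which is common; the other three literals over [V]
   are excluded from [T] or [U]. *)
have disV : V `&` varF (T `&` U) = fset0.
  apply/fsetP => u; rewrite in_fset0 in_fsetI; apply/negP => /andP [uV /varFP [C]].
  rewrite in_fsetI => /andP [CT CU] [l lC lu].
  have /andP [xT yT] := aT C CT; have /andP [_ yU] := aU C CU.
  move: uV; rewrite !inE -lu => /orP [] /eqP /lit_var_eq /orP [] /eqP e.
  - have : C \in occ F x by rewrite occE (fsubsetP TF) // -e.
    by rewrite eo !inE => /orP [] /eqP eC; rewrite -eC ?CT ?CU in E1T E2U.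
  - by rewrite -e lC in xT.
  - by rewrite -e lC in yT.
  - by rewrite -e lC in yU.
have leI := fsubset_leq_card subI.
have cI := cardfsUI V (varF (T `&` U)); rewrite disV cardfs0 cV addn0 in cI.
rewrite cI in leI; rewrite -/(nvars (T `&` U)) in leI.
have TU0 : T `&` U = fset0.
  apply/eqP; apply: contraT => TU0.
  have pTU : T `&` U `<` F.
    rewrite fproperEneq (fsubset_trans (fsubsetIl _ _) TF) andbT.
    by apply/eqP => e; move: E1T; have := E1F; rewrite -e in_fsetI => /andP [->].
  have c3 : #|`F `\` (T `&` U)| <= 2.
    apply: (deficiency0_subset nsF pTU TU0).
    by move: cTU cv nT nU leI; clear; lia.
  have : E1 |` (E2 |` occ F (compl x)) `<=` F `\` (T `&` U).
    apply/fsubsetP => C; rewrite !in_fset1U occE in_fsetD in_fsetI.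
    case/orP => [/eqP ->|/orP [/eqP ->|/andP [-> xC]]].
    - by rewrite E1F (negbTE E1T).
    - by rewrite E2F (negbTE E2U) andbF.
    - by rewrite andbT; apply/nandP; left; apply/negP => /aT; rewrite xC.
  move=> /fsubset_leq_card le; have := leq_trans le c3.
  rewrite !cardfsU1 !in_fset1U !occE (negbTE nx1) (negbTE nx2) (negbTE ne) !andbF.
  by rewrite -[#|`occ _ _|]/(ldeg F (compl x)) d2.
rewrite TU0 cardfs0 in cTU.
exists T, U; split=> //; first by rewrite -cTU addn0.
move=> u uT uU; have eqI : V = varF T `&` varF U.
  apply/eqP; rewrite eqEfcard cV; apply/andP; split.
    by apply: fsubset_trans subI; apply: fsubsetUl.
  by move: cTU cv nT nU; clear; lia.
by rewrite eqI in_fsetI uT.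
Qed.

Lemma clash_uniq F x y E1 E2 y' : nonsingular2 F -> clash F x y E1 E2 ->
  y' \in E1 -> compl y' \in E2 -> y'.1 != x.1 -> y'.1 = y.1.
Proof.
move=> nsF cl y1 y2 yx; have [T [U [_ _ [_ _ E2T] [_ _ E1U] hTU]]] := clash_decomposition nsF cl.
have := hTU y'.1 (mem_varF E2T y2) (mem_varF E1U y1).
by rewrite !inE (negbTE yx) => /eqP.
Qed.

Lemma clash_ldeg F x y E1 E2 z : nonsingular2 F -> clash F x y E1 E2 ->
  (forall b, 0 < ldeg (occ F x) (z, b)) -> z != x.1 -> z = y.1.
Proof.
move=> nsF cl h zx; have [E1F E2F x1 x2] := clashP cl; have [_ cF _ _] := nsF.
have [eo _ _ _ _] := cl.
have [b zb zb'] : exists2 b, (z, b) \in E1 & (z, ~~ b) \in E2.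
  have /ldeg_gt0P [C oC zC] := h true; have /ldeg_gt0P [D oD zD] := h false.
  move: oC oD zC zD; rewrite eo !inE => /orP [] /eqP -> /orP [] /eqP -> zC zD.
  - by have := cF _ E1F _ zC; rewrite zD.
  - by exists true.
  - by exists false.
  - by have := cF _ E2F _ zC; rewrite zD.
exact: (clash_uniq (y' := (z, b)) nsF cl).
Qed.

(** * Binary clauses and the cycle structure *)

Lemma rMU_closed_clause V U E : rMU V U -> E \in U -> (forall l, l \in E -> l.1 \in V) ->
  U = [fset E].
Proof.
move=> mU EU EV; apply/esym/(rMU_eq mU); first by rewrite fsub1set.
case=> f /(_ E); rewrite inE eqxx => /(_ isT) [l lE /andP [lV _]].
by rewrite EV in lV.
Qed.

Lemma rnv0_clause V T E : rnv V T = 0 -> E \in T -> forall l, l \in E -> l.1 \in V.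
Proof.
move=> /eqP; rewrite cardfs_eq0 fsetD_eq0 => /fsubsetP VT ET l lE.
exact/VT/(mem_varF ET lE).
Qed.

Lemma eq_fset2 E x y : is_clause E -> x \in E -> y \in E ->
  (forall l, l \in E -> l.1 \in [fset x.1; y.1]) -> E = [fset x; y].
Proof.
move=> cE xE yE EV; apply/fsetP => l; rewrite !inE; apply/idP/orP => [lE|[] /eqP -> //].
move: (EV l lE); rewrite !inE => /orP [] /eqP /lit_var_eq /orP [] /eqP e; subst l.
- by left.
- by rewrite (negbTE (cE x xE)) in lE.
- by right.
- by rewrite (negbTE (cE y yE)) in lE.
Qed.

(** An [x]-clause is binary when its part of the decomposition has no variable outside [V]. The
    equivalence records that both are binary only for two variables. *)
Lemma binary_clause F x : nonsingular2 F -> x.1 \in varF F ->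
  exists y E1 E2, [/\ clash F x y E1 E2, E1 = [fset x; y] &
                      E2 = [fset x; compl y] <-> nvars F = 2].
Proof.
move=> nsF xF; have [mF cF eF dF] := nsF; have [y [E1 [E2 cl]]] := clash_exists nsF xF.
have [T [U [eN cN [mT rT E2T] [mU rU E1U] hTU]]] := clash_decomposition nsF cl.
have [E1F E2F x1 x2] := clashP cl; have [_ _ _ y1 y2] := cl.
set V := [fset x.1; y.1] in mT rT mU rU hTU.
have xF' : (compl x).1 \in varF F by [].
have [y0 [D1 [D2 cl0]]] := clash_exists nsF xF'.
have E2b : (E2 = [fset x; compl y]) <-> rnv V T = 0.
  split=> [e|/rnv0_clause e].
    suff : T = [fset E2] by move=> eT; move: rT; rewrite {2}eT cardfs1 => -[].
    apply: (rMU_closed_clause mT E2T) => l; rewrite e !inE.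
    by move=> /orP [] /eqP ->; rewrite eqxx ?orbT.
  by apply: eq_fset2 => //; [apply: cF | apply: (e E2)].
have E1b : (E1 = [fset x; y]) <-> rnv V U = 0.
  split=> [e|/rnv0_clause e].
    suff : U = [fset E1] by move=> eU; move: rU; rewrite {2}eU cardfs1 => -[].
    apply: (rMU_closed_clause mU E1U) => l; rewrite e !inE.
    by move=> /orP [] /eqP ->; rewrite eqxx ?orbT.
  by apply: eq_fset2 => //; [apply: cF | apply: (e E1)].
(* A variable of degrees (1,1) in [T] or [U] recovers its missing occurrences in
   the two clauses containing the complement of [x], and those have only one
   clashing variable. *)
have sing W W' : rMU V W -> (rnv V W).+1 = #|`W| -> W `|` W' = F `\` occ F (compl x) ->
    (forall u, u \in varF W -> u \in varF W' -> u \in V) -> 0 < rnv V W ->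
    y0.1 \in varF W `\` V.
  move=> mW rW eW hW posW; have [|z zW dz] := rMU1_singular mW _ posW; first by rewrite rW.
  move: (zW); rewrite in_fsetD => /andP [zV zW'].
  have zx : z != x.1 by apply: contraNneq zV => ->; rewrite !inE eqxx.
  suff <- : z = y0.1 by [].
  apply: (clash_ldeg nsF cl0) => // b; apply: nonsingular2_ldeg_occ => //.
    apply: (fsubsetP (varFS (fsubsetDl F (occ F (compl x))))).
    by rewrite -eW varFU in_fsetU zW'.
  rewrite -eW; apply: leq_trans (ldegU _ _ _) _; rewrite dz (ldeg_notin (F := W')) //=.
  by apply: contra zV => zW''; apply: hW.
have /orP [/eqP T0|/eqP U0] : (rnv V T == 0) || (rnv V U == 0).
- apply: contraT; rewrite negb_or -!lt0n => /andP [posT posU].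
  have := sing T U mT rT eN hTU posT; have := sing U T mU rU.
  rewrite fsetUC => /(_ eN (fun u a b => hTU u b a) posU).
  by rewrite !in_fsetD => /andP [y0V y0U] /andP [_ y0T]; rewrite hTU in y0V.
- exists (compl y), E2, E1; split; [exact: clash_sym | exact/E2b | rewrite complK].
  by rewrite E1b; move: rT rU cN T0; clear; lia.
- exists y, E1, E2; split; [by [] | exact/E1b | ].
  by rewrite E2b; move: rT rU cN U0; clear; lia.
Qed.

Lemma nonsingular2_varF_neq0 F : nonsingular2 F -> varF F != fset0.
Proof.
case=> mF cF eF dF; apply/eqP => v0; have : F `<=` [fset fset0].
  apply/fsubsetP => C CF; rewrite inE; apply/eqP/fsetP => l; rewrite in_fset0.
  by apply/negP => /(mem_varF CF); rewrite v0.
by move=> /fsubset_leq_card; rewrite cardfs1 eF; lia.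
Qed.

(** [L] is the partner of a binary clause of an arbitrary literal. For [x] in [L], either [L] is
    also the partner of the binary clause of [x], or [L] is binary itself; then there are two
    variables and the partner is binary too. *)
Lemma hub_clause F : nonsingular2 F -> exists L, [/\ L \in F, L != fset0 &
  forall x, x \in L -> exists2 z, z \in L & [fset x; compl z] \in F].
Proof.
move=> nsF; have [mF cF eF dF] := nsF.
have /fset0Pn [u uF] := nonsingular2_varF_neq0 nsF.
have [y [E1 [L [cl b1 b2]]]] := binary_clause (x := (u, true)) nsF uF.
have [E1F LF x1 xL] := clashP cl; have [_ _ yx _ y2] := cl.
exists L; split=> //; first by apply/fset0Pn; exists (u, true).
move=> x xL'; have [y' [D1 [D2 [cl' b1' b2']]]] := binary_clause nsF (mem_varF LF xL').
have [D1F D2F x1' x2'] := clashP cl'; have [eo' _ yx' y1' y2'] := cl'.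
have : L \in occ F x by rewrite occE LF.
rewrite eo' !inE => /orP [] /eqP eL; last first.
  by exists (compl y'); rewrite ?eL // complK -b1'.
exists y'; first by rewrite eL.
suff -> : [fset x; compl y'] = D2 by [].
apply/esym/b2'/b2/esym/eqP; rewrite eqEfcard !cardfs2.
have -> : (u, true) != compl y by apply: contraNneq yx => ->.
apply/andP; split; last by rewrite eL b1' cardfs2; case: (_ != _).
by apply/fsubsetP => l; rewrite !inE => /orP [] /eqP ->.
Qed.

(** Each binary clause says that the next literal implies the current one, so all are equivalent,
    against the first two clauses. *)
Definition cycle_clauses (s : seq lit) : clauseset :=
  [fset [fset x in s]; complC [fset x in s]] `|`
  [fset [fset x; compl (next s x)] | x in s].

Lemma mem_complC D l : (l \in complC D) = (compl l \in D).
Proof.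
apply/imfsetP/idP => /= [[x xD ->]|lD]; first by rewrite complK.
by exists (compl l); rewrite ?complK.
Qed.

Lemma card_varC C : is_clause C -> #|`varC C| = #|`C|.
Proof.
move=> cC; apply: card_in_imfset => x y /= xC yC /lit_var_eq /orP [] /eqP // e.
by have := cC y yC; rewrite -e xC.
Qed.

(** The binary clauses [J] have deficiency at least 0, so only [L] and one clause [L'] lie outside;
    degree 2 of every literal then makes [tau] onto and determines [L']. *)
Lemma nonsingular2_hub F L (tau : lit -> lit) : nonsingular2 F -> L \in F -> L != fset0 ->
  (forall x, x \in L -> tau x \in L /\ [fset x; compl (tau x)] \in F) ->
  [/\ #|`L| = nvars F, {in L &, injective tau} &
      F = [fset L; complC L] `|` [fset [fset x; compl (tau x)] | x in L]].
Proof.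
move=> nsF LF L0 hL; have [mF cF eF dF] := nsF; have cL := cF L LF.
set J := [fset _ | x in L].
have binP x z : x \in L -> z \in L -> z \in [fset x; compl (tau x)] -> z = x.
  move=> xL zL; rewrite !inE => /orP [] /eqP // e.
  by have := cL _ (hL x xL).1; rewrite -e zL.
have JP D : reflect (exists2 x, x \in L & D = [fset x; compl (tau x)]) (D \in J).
  by apply: (iffP (imfsetP _ _ _ _)).
have cJ : #|`J| = #|`L|.
  apply: card_in_imfset => x z /= xL zL e; apply: (binP z x) => //.
  by rewrite -e !inE eqxx.
have JF : J `<=` F by apply/fsubsetP => D /JP [x xL ->]; case: (hL x xL).
have LJ : L \notin J.
  apply/negP => /JP [x xL eL]; have [tL _] := hL x xL.
  by have := cL _ tL; rewrite eL !inE eqxx orbT.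
have vJ : nvars J <= #|`L|.
  rewrite -card_varC //; apply: fsubset_leq_card; apply/fsubsetP => v.
  case/varFP => D /JP [x xL ->] [l]; rewrite !inE => /orP [] /eqP -> <-.
    exact: mem_varC.
  exact: mem_varC (hL x xL).1.
have J0 : J != fset0 by rewrite -cardfs_gt0 cJ cardfs_gt0.
have pJ : J `<` F by rewrite fproperE JF; apply/fsubsetPn; exists L.
have c2 : #|`F `\` J| <= 2 by apply: (deficiency0_subset nsF pJ J0); rewrite cJ.
have subL : varC L `<=` varF F by apply/fsubsetP => v /varCP [l lL <-]; apply: mem_varF lL.
have leL := fsubset_leq_card subL; rewrite card_varC // -[#|`varF F|]/(nvars F) in leL.
have cFJ := cardfsDS JF.
have eL : #|`L| = nvars F by lia.
have vL : varC L = varF F by apply/eqP; rewrite eqEfcard subL card_varC // eL leqnn.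
have LFJ : L \in F `\` J by rewrite inE LJ.
have c1 : #|`(F `\` J) `\ L| = 1 by have := cardfsD1 L (F `\` J); rewrite LFJ; lia.
have /eqP/cardfs1P [L' eL'] := c1.
have FE : F = [fset L; L'] `|` J.
  rewrite -(fsetU_compl JF) fsetUC; congr (_ `|` _).
  by rewrite -(fsetD1K LFJ) eL'.
have L'F : L' \in F by rewrite FE !inE eqxx orbT.
have L'J : L' \notin J.
  have : L' \in [fset L'] by rewrite inE.
  by rewrite -eL' !inE => /andP [_ /andP [->]].
have LL' : L' != L.
  have : L' \in [fset L'] by rewrite inE.
  by rewrite -eL' !inE => /andP [->].
have d2 x : x \in L -> ldeg F x = 2 /\ ldeg F (compl x) = 2.
  move=> xL; have xF := mem_varF LF xL.
  by have [] := nonsingular2_cofactor nsF xF; have [] := nonsingular2_cofactor (x := compl x) nsF xF.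
(* The complement of a literal outside the image of [tau] could occur only in [L'], against degree
   2. *)
have surj : tau @` L = L.
  apply/fsetP => x; apply/imfsetP/idP => /= [[z /hL [zL _] -> //]|xL].
  apply: NNPP => nx; have [_] := d2 x xL.
  suff : ldeg F (compl x) <= 1 by move=> h e; rewrite e in h.
  rewrite -(cardfs1 L'); apply: fsubset_leq_card; apply/fsubsetP => C.
  rewrite occE FE !inE -orbA => /andP [/or3P [/eqP ->||/JP [z zL ->]] xC] //.
    by rewrite (negbTE (cL x xL)) in xC.
  move: xC; rewrite !inE => /orP [] /eqP e.
    by have := cL x xL; rewrite e zL.
  by case: nx; exists z => //; rewrite -[x]complK e complK.
have inj : {in L &, injective tau} by apply/card_in_imfsetP; rewrite surj.
have L'x x : x \in L -> compl x \in L'.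
  move=> xL; have [_ d] := d2 x xL; apply: contraT => xL'.
  have : x \in tau @` L by rewrite surj.
  case/imfsetP => /= z zL ez; suff : ldeg F (compl x) <= 1 by rewrite d.
  rewrite -(cardfs1 [fset z; compl (tau z)]); apply: fsubset_leq_card.
  apply/fsubsetP => C; rewrite occE FE !inE -orbA.
  case/andP => /or3P [/eqP ->|/eqP ->|/JP [t tL ->]] xC.
  - by rewrite (negbTE (cL x xL)) in xC.
  - by rewrite (negbTE xL') in xC.
  move: xC; rewrite !inE => /orP [] /eqP e.
    by have := cL x xL; rewrite e tL.
  have -> // : t = z by apply: inj => //; rewrite -ez -[tau t]complK -e complK.
have xL' x : x \in L -> x \notin L'.
  move=> xL; apply/negP => xL'; have [d _] := d2 x xL.
  have [_ tF] := hL x xL; pose D := [fset x; compl (tau x)].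
  have DJ : D \in J by apply/JP; exists x.
  suff : 3 <= ldeg F x by rewrite d.
  have <- : #|` D |` [fset L; L']| = 3.
    have /negbTE DL : D != L by apply: contraNneq LJ => <-.
    have /negbTE DL' : D != L' by apply: contraNneq L'J => <-.
    by rewrite cardfsU1 cardfs2 [L == _]eq_sym LL' in_fset2 DL DL'.
  apply: fsubset_leq_card; apply/fsubsetP => C; rewrite in_fset1U in_fset2 occE.
  by case/or3P => /eqP ->; rewrite ?LF ?L'F ?tF //= !inE eqxx.
split=> //; rewrite FE; congr ([fset L; _] `|` _); apply/fsetP => l.
rewrite mem_complC; apply/idP/idP => [lL'|/L'x]; last by rewrite complK.
have : l.1 \in varC L by rewrite vL; apply: mem_varF lL'.
case/varCP => z zL /lit_var_eq /orP [] /eqP e; last by rewrite -e.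
by have := xL' z zL; rewrite e lL'.
Qed.

Lemma nonsingular2_cycle F : nonsingular2 F ->
  exists s : seq lit, [/\ uniq (map fst s), size s = nvars F & F = cycle_clauses s].
Proof.
move=> nsF; have [mF cF eF dF] := nsF; have [L [LF L0 hL]] := hub_clause nsF.
pose P x (z : lit) := [fset x; compl z] \in F.
pose tau x := odflt x (omap val [pick z : L | P x (val z)]).
have tauL x : x \in L -> tau x \in L /\ P x (tau x).
  move=> xL; rewrite /tau; case: pickP => /= [z Pz|nP]; first by rewrite fsvalP.
  by have [z zL Pz] := hL x xL; have := nP [`zL]; rewrite /= /P Pz.
have [cL injt FE] := nonsingular2_hub nsF LF L0 tauL.
have clL := cF L LF.
pose t (x : L) : L := [`(tauL (val x) (fsvalP x)).1].
(* Otherwise the literals of [L] in [S] can be made false and the others true. *)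
have conn (S : {pred L}) (x0 : L) : x0 \in S -> (forall z : L, z \in S -> t z \in S) ->
    forall z : L, z \in S.
  move=> x0S St w0; apply: contraT => w0S.
  pose inS (l : lit) := [exists z : L, (z \in S) && (val z == l)].
  have inSP (z : L) : inS (val z) = (z \in S).
    apply/existsP/idP => [[w /andP [wS /eqP /val_inj <-]] //|zS].
    by exists z; rewrite zS /=.
  (* [L] has at most one literal of each variable; [f] makes it true exactly when it is outside
     [S]. *)
  pose f v := if (v, true) \in L then ~~ inS (v, true) else inS (v, false).
  have fL l : l \in L -> (f l.1 == l.2) = ~~ inS l.
    case: l => v [] lL; rewrite /f /=; first by rewrite lL eqb_id.
    by rewrite (negbTE (clL _ lL)) eqbF_neg.
  case: mF => nF _; case: nF; exists f => C; rewrite FE !inE -orbA.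
  case/or3P => [/eqP ->|/eqP ->|/imfsetP [/= l lL ->]].
  - by exists (val w0); rewrite ?fsvalP // in_fset0 fL ?fsvalP // inSP w0S.
  - exists (compl (val x0)); rewrite ?mem_complC ?complK ?fsvalP // in_fset0 /=.
    by rewrite eval_compl fL ?fsvalP // inSP x0S.
  pose z : L := [`lL]; have [zS|zS] := boolP (z \in S).
    exists (compl (tau l)); first by rewrite !inE eqxx orbT.
    rewrite eval_compl fL; last by case: (tauL l lL).
    by rewrite negbK (inSP (t z)) St.
  exists l; first by rewrite !inE eqxx.
  by rewrite fL // (inSP z) zS.
(* Orbits are closed under [t], so there is only one and [tau] is a cyclic permutation of [L]. *)
have orbL (x : L) : forall y : L, y \in orbit t x.
  by apply: (conn _ x) => [|y]; [apply: in_orbit | apply: mem_orbit].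
have /fset0Pn [x0 x0L] := L0.
pose o := orbit t [`x0L]; pose s : seq lit := map val o.
have uo : uniq o by apply: orbit_uniq.
have sL l : (l \in s) = (l \in L).
  apply/mapP/idP => [[z _ ->]|lL]; first exact: fsvalP.
  by exists [`lL]; first exact: orbL.
have us : uniq s by rewrite map_inj_uniq //; apply: val_inj.
have eL : [fset x in s] = L by apply/fsetP => l; rewrite !inE sL.
have cyc : fcycle t o by rewrite -fconnect_f fconnect_orbit.
have nx l : l \in L -> next s l = tau l.
  move=> lL; rewrite -[l]/(val [`lL]) (next_map val_inj uo).
  by rewrite -(eqP (next_cycle cyc (orbL _ _))).
exists s; split.
- rewrite map_inj_in_uniq // => x y; rewrite !sL => xL yL.
  by move=> /lit_var_eq /orP [] /eqP // e; have := clL y yL; rewrite -e xL.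
- by rewrite -cL -eL card_fseq undup_id.
rewrite {1}FE /cycle_clauses eL; congr (_ `|` _).
apply/fsetP => D; apply/imfsetP/imfsetP => /= -[l lL ->]; exists l => //.
- by rewrite sL.
- by rewrite nx.
- by rewrite -sL.
- by rewrite nx // -sL.
Qed.

(** * Isomorphism *)

Definition swap_lit (a b l : lit) : lit :=
  if l == a then b else if l == compl a then compl b else
  if l == b then a else if l == compl b then compl a else l.

Lemma swap_litC a b l : swap_lit a b (compl l) = compl (swap_lit a b l).
Proof.
rewrite /swap_lit !eq_compl !complK.
have nc x : x <> compl x by move/eqP; rewrite eq_sym (negbTE (compl_neq x)).
have [->|_] := eqVneq l a.
  by case: eqP => [/nc|_]; rewrite ?complK.
have [_|_] := eqVneq l (compl a); first by rewrite complK.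
have [->|_] := eqVneq l b; first by case: eqP => [/nc|_]; rewrite ?complK.
by case: eqP => _ //; rewrite complK.
Qed.

Lemma swap_litK a b : involutive (swap_lit a b).
Proof.
have sa : swap_lit a b a = b by rewrite /swap_lit eqxx.
have sb : swap_lit a b b = a.
  rewrite /swap_lit; case: eqP => [-> //|_]; case: eqP => [->|_]; first by rewrite complK.
  by rewrite eqxx.
move=> l; have [->|la] := eqVneq l a; first by rewrite sa sb.
have [->|la'] := eqVneq l (compl a); first by rewrite !swap_litC sa sb.
have [->|lb] := eqVneq l b; first by rewrite sb sa.
have [->|lb'] := eqVneq l (compl b); first by rewrite !swap_litC sb sa.
have sl : swap_lit a b l = l.
  by rewrite /swap_lit (negbTE la) (negbTE la') (negbTE lb) (negbTE lb').
by rewrite sl.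
Qed.

(** The bijection for the tails is followed by a swap of the image of [a] with [b], which fixes [t]
    because its variables differ from both. *)
Lemma lit_extension (s t : seq lit) :
  uniq (map fst s) -> uniq (map fst t) -> size s = size t ->
  exists f : lit -> lit, [/\ bijective f, (forall x, f (compl x) = compl (f x)) & map f s = t].
Proof.
elim: s t => [|a s IH] [|b t] //=; first by exists id; split=> //; exists id.
move=> /andP [as_ us] /andP [bt ut] [est].
have [f [bf fC fst_]] := IH t us ut est.
exists (swap_lit (f a) b \o f); split=> [||/=].
- apply: bij_comp bf; exact: inv_bij (swap_litK _ _).
- by move=> x /=; rewrite fC swap_litC.
rewrite {1}/swap_lit eqxx; congr (_ :: _); rewrite -fst_; apply/eq_in_map => x xs /=.
have xt : f x \in t by rewrite -fst_ map_f.
have xa : x.1 != a.1 by apply: contraNneq as_ => <-; apply: map_f.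
have xb : (f x).1 != b.1 by apply: contraNneq bt => <-; apply: map_f.
rewrite /swap_lit -fC !(inj_eq (bij_inj bf)).
have -> : (x == a) = false by apply/eqP => e; rewrite e eqxx in xa.
have -> : (x == compl a) = false by apply/eqP => e; rewrite e eqxx in xa.
have -> : (f x == b) = false by apply/eqP => e; rewrite e eqxx in xb.
by have -> : (f x == compl b) = false by apply/eqP => e; rewrite e eqxx in xb.
Qed.

Lemma cycle_clauses_isomorphic (s t : seq lit) :
  uniq (map fst s) -> uniq (map fst t) -> size s = size t ->
  isomorphic (cycle_clauses s) (cycle_clauses t).
Proof.
move=> us ut est; have [f [bf fC fst_]] := lit_extension us ut est.
have us' : uniq s by apply: map_uniq us.
exists f; split=> //; split=> //.
have imC (A B : clause) : (forall l, (l \in A) = (f l \in B)) -> [fset f x | x in A] = B.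
  move=> AB; have [g fK gK] := bf; apply/fsetP => l; apply/imfsetP/idP => /= [[x xA ->]|lB].
    by rewrite -AB.
  by exists (g l); rewrite ?gK // AB gK.
have e1 : [fset f x | x in [fset x in s]] = [fset x in t].
  by apply: imC => l; rewrite !inE -fst_ (mem_map (bij_inj bf)).
have e2 : [fset f x | x in complC [fset x in s]] = complC [fset x in t].
  by apply: imC => l; rewrite !mem_complC !inE -fC -fst_ (mem_map (bij_inj bf)).
rewrite /cycle_clauses imfsetU imfset_fset2 e1 e2; congr (_ `|` _).
apply/fsetP => D; apply/imfsetP/imfsetP => /= [[C /imfsetP [x xs ->] ->]|[y]].
  exists (f x); first by rewrite -fst_ map_f.
  by rewrite imfset_fset2 fC -fst_ (next_map (bij_inj bf)).
rewrite -{1}fst_ => /mapP [x xs ->] ->; exists [fset x; compl (next s x)].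
  by apply/imfsetP; exists x.
by rewrite imfset_fset2 fC -fst_ (next_map (bij_inj bf)).
Qed.

(** * Singular DP-reduction *)

Lemma sat_clauseP f C : reflect (exists2 l, l \in C & f l.1 == l.2) (sat_clause f C).
Proof.
apply: (iffP existsP) => [[l h]|[l lC h]]; first by exists (val l); rewrite ?fsvalP.
by exists [`lC].
Qed.

Lemma satisfiable_rsat F : satisfiable F <-> rsat fset0 F.
Proof.
split=> -[f fF]; exists f => C /fF.
  by move=> /sat_clauseP [l lC h]; exists l; rewrite // in_fset0.
by move=> [l lC /andP [_ h]]; apply/sat_clauseP; exists l.
Qed.

Lemma MU_rMU F : MU F <-> is_clauseset F /\ rMU fset0 F.
Proof.
split=> [[cF [nF mF]]|[cF [nF mF]]]; do !split=> //; rewrite -?satisfiable_rsat //.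
- by move=> C CF; apply/satisfiable_rsat/mF.
- by rewrite satisfiable_rsat.
- by move=> C CF; apply/satisfiable_rsat/mF.
Qed.

(** * Singular DP-reduction as a map on clauses *)

Definition unique_occ F x C : Prop := C \in F /\ forall D, D \in F -> (x \in D) = (D == C).

Lemma unique_occP F x : ldeg F x = 1 <-> exists C, unique_occ F x C.
Proof.
split=> [/eqP/cardfs1P [C eC]|[C [CF CP]]].
  exists C; have oC D : (D \in F) && (x \in D) = (D == C) by rewrite -occE /occ eC inE.
  split=> [|D DF]; first by have := oC C; rewrite eqxx => /andP [].
  by rewrite -oC DF.
rewrite -(cardfs1 C); congr #|` _|; apply/fsetP => D; rewrite occE inE.
by case: (boolP (D \in F)) => [/CP|DF] //=; apply/esym; apply: contraNF DF => /eqP ->.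
Qed.

Lemma unique_occ_mem F x C : unique_occ F x C -> x \in C.
Proof. by case=> CF CP; rewrite CP. Qed.

Lemma ldeg_varF F x : 0 < ldeg F x -> x.1 \in varF F.
Proof. by case/ldeg_gt0P => C CF xC; apply: mem_varF xC. Qed.

Lemma MU_ldeg_gt0 F x : MU F -> x.1 \in varF F -> 0 < ldeg F x.
Proof. by case/MU_rMU => _ mF xF; apply: rMU_ldeg_gt0 mF xF _. Qed.

Lemma singularP F v : MU F ->
  singular F v <-> exists2 x, x.1 = v & ldeg F x = 1.
Proof.
move=> mF; rewrite /singular; split.
  rewrite /minn; case: ifP => _ h; first by exists (v, true).
  by exists (v, false).
case=> -[w b] /= -> d.
have h c : 0 < ldeg F (v, c) by apply: (MU_ldeg_gt0 mF); apply: (@ldeg_varF F (v, b)); rewrite d.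
by have := h true; have := h false; case: b d; lia.
Qed.

(** Clauses without [compl x] are kept, so reduction is a map on the clauses other than [C] and
    clauses can be counted through it. *)
Definition resolve x C D : clause :=
  if compl x \in D then (C `|` D) `\` [fset x; compl x] else D.

Lemma mem_resolve x C D l : (l \in resolve x C D) =
  if compl x \in D then [&& l != x, l != compl x & (l \in C) || (l \in D)] else l \in D.
Proof. by rewrite /resolve; case: ifP => // _; rewrite !inE negb_or andbA. Qed.

Definition sDP x C F : clauseset := [fset resolve x C D | D in F `\ C].

Lemma sDP_P x C F E :
  reflect (exists2 D, (D \in F) && (D != C) & E = resolve x C D) (E \in sDP x C F).
Proof.
apply: (iffP (imfsetP _ _ _ _)) => /= -[D]; rewrite ?inE => h ->; exists D => //.
  by rewrite andbC.
by rewrite in_fsetD1 andbC.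
Qed.

Section Main.

Variables (F : clauseset) (x : lit) (C : clause).
Hypotheses (mF : MU F) (uC : unique_occ F x C).

(** If the model of the rest made another literal of [C] true, making [x] false would satisfy [D]
    and keep all other clauses, as only [C] contains [x]. *)
Lemma MU_falsifier D : D \in F -> compl x \in D ->
  exists f : nat -> bool, [/\ forall E, E \in F `\ D -> exists2 l, l \in E & f l.1 == l.2,
    forall l, l \in D -> f l.1 != l.2 & forall l, l \in C -> l != x -> f l.1 != l.2].
Proof.
move=> DF xD; have [cF [nF /(_ D DF) [f fD]]] := mF; have [CF CP] := uC.
have fE E : E \in F `\ D -> exists2 l, l \in E & f l.1 == l.2 by move=> /fD /sat_clauseP.
have fD' l : l \in D -> f l.1 != l.2.
  move=> lD; apply/negP => h; apply: nF; exists f => E EF; apply/sat_clauseP.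
  have [->|ED] := eqVneq E D; first by exists l.
  by apply: fE; rewrite !inE ED.
exists f; split=> // l lC lx; apply/negP => h; apply: nF.
exists (fun u => if u == x.1 then ~~ x.2 else f u) => E EF; apply/sat_clauseP.
have keep k : k \in E -> k != x -> f k.1 == k.2 -> (if k.1 == x.1 then ~~ x.2 else f k.1) == k.2.
  move=> kE kx fk; case: (k.1 =P x.1) => // /lit_var_eq /orP [] /eqP e; last by rewrite e.
  by rewrite e eqxx in kx.
have [eC|EC] := eqVneq E C; first by exists l; rewrite ?keep ?eC.
have [->|ED] := eqVneq E D; first by exists (compl x); rewrite //= !eqxx.
have [|k kE fk] := fE E; first by rewrite !inE ED.
exists k => //; apply: keep => //; apply: contraNneq EC => kx.
by rewrite -CP // -kx.
Qed.

Lemma MU_one_clash D l : D \in F -> compl x \in D -> l \in C -> compl l \in D -> l = x.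
Proof.
move=> DF xD lC lD; have [f [_ fD fC]] := MU_falsifier DF xD.
apply/eqP; apply: contraT => lx; have := fC l lC lx; have := fD _ lD.
by rewrite eval_compl negbK => ->.
Qed.

Lemma compl_notin_main : compl x \notin C.
Proof. by have [cF _] := mF; apply: cF; [case: uC | apply: unique_occ_mem uC]. Qed.

(** A falsifier of [D] falsifies its resolvent, but satisfies any other clause by a literal that
    survives in its image. *)
Lemma resolve_inj : {in F `\ C &, injective (resolve x C)}.
Proof.
have [CF CP] := uC.
have aux D E : D \in F -> E \in F -> E != C -> compl x \in D ->
    resolve x C D = resolve x C E -> D = E.
  move=> DF EF EC xD eR; have [f [fE fD fC]] := MU_falsifier DF xD.
  apply/eqP; apply: contraT => ne; have [|l lE fl] := fE E; first by rewrite !inE eq_sym ne.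
  have lx : l != x by apply: contraNneq EC => lx; rewrite -CP // -lx.
  have lx' : l != compl x by apply: contraTneq fl => ->; apply: fD.
  have : l \in resolve x C D by rewrite eR mem_resolve lx lx' lE orbT; case: ifP.
  rewrite mem_resolve xD lx lx' /= => /orP [lC|lD]; first by have := fC l lC lx; rewrite fl.
  by have := fD l lD; rewrite fl.
move=> D E; rewrite !inE => /andP [DC DF] /andP [EC EF] eR.
have [xD|xD] := boolP (compl x \in D); first exact: aux.
have [xE|xE] := boolP (compl x \in E); first by apply/esym/aux.
by move: eR; rewrite /resolve (negbTE xD) (negbTE xE).
Qed.

Lemma ex_side : exists2 D, D \in F & compl x \in D.
Proof.
apply/ldeg_gt0P/(MU_ldeg_gt0 mF).
by have [CF _] := uC; apply: mem_varF CF (unique_occ_mem uC).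
Qed.

Lemma side_neq_main D : compl x \in D -> D != C.
Proof. by apply: contraTneq => ->; apply: compl_notin_main. Qed.

Lemma sDP_clauseset : is_clauseset (sDP x C F).
Proof.
have [cF _] := mF; have [CF CP] := uC.
move=> E /sDP_P [D /andP [DF DC] ->] l; rewrite !mem_resolve; case: ifP => xD; last exact: cF.
case/and3P => lx lx' lCD; apply/negP => /and3P [_ _ lCD'].
case/orP: lCD => h; case/orP: lCD' => h'.
- by have := cF C CF _ h; rewrite h'.
- by rewrite (MU_one_clash DF xD h h') eqxx in lx.
- by have := MU_one_clash DF xD h'; rewrite complK => /(_ h) e; rewrite -e complK eqxx in lx'.
- by have := cF D DF _ h; rewrite h'.
Qed.

(** A model of the reduct becomes one of [F] by making [x] false exactly when another literal of [C]
    is true. Conversely, where a clause relies on [compl x], its resolvent gets a true literal from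
    [C]. *)
Lemma MU_sDP : MU (sDP x C F).
Proof.
have [cF [nF mF']] := mF; have [CF CP] := uC.
split; first exact: sDP_clauseset.
split=> [[f fG]|_ /sDP_P [D /andP [DF DC] ->]].
  apply: nF; pose b := [exists l : C, (val l != x) && (f (val l).1 == (val l).2)].
  have kx E k : E \in F -> E != C -> k \in E -> k != x.
    by move=> EF EC kE; apply: contraNneq EC => ek; rewrite -CP // -ek.
  exists (fun u => if u == x.1 then (if b then ~~ x.2 else x.2) else f u) => E EF.
  apply/sat_clauseP.
  have keep k : k != x -> k != compl x -> f k.1 == k.2 ->
      (if k.1 == x.1 then (if b then ~~ x.2 else x.2) else f k.1) == k.2.
    move=> kx1 kx2 fk; case: (k.1 =P x.1) => // /lit_var_eq.
    by rewrite (negbTE kx1) (negbTE kx2).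
  have [eC|EC] := eqVneq E C.
    case: (boolP b) keep => [/existsP [k /andP [kx1 fk]]|nb] keep.
      exists (val k); rewrite ?eC ?fsvalP // keep //.
      by apply: contraTneq (fsvalP k) => ->; apply: compl_notin_main.
    by exists x; rewrite ?eqxx // eC (unique_occ_mem uC).
  have /fG/sat_clauseP [k] : resolve x C E \in sDP x C F.
    by apply/sDP_P; exists E; rewrite // EF.
  rewrite mem_resolve; have [xE|xE] := boolP (compl x \in E).
    case/and3P => kx1 kx2 kCE fk; case: (boolP b) keep => [_|nb] keep.
      by exists (compl x); rewrite //= eqxx.
    case/orP: kCE => [kC|kE]; last by exists k; rewrite ?keep.
    by case/existsP: nb; exists [`kC]; rewrite /= kx1.
  move=> kE fk; exists k => //; apply: keep => //; first exact: kx kE.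
  by apply: contraNneq xE => <-.
have [f fD] := mF' D DF; exists f => G; rewrite !inE => /andP [GD /sDP_P [E /andP [EF EC] eG]].
have ED : E != D by apply: contraNneq GD => <-; rewrite eG.
have fs H : H \in F -> H != D -> exists2 l, l \in H & f l.1 == l.2.
  by move=> HF HD; apply/sat_clauseP/fD; rewrite !inE HD.
apply/sat_clauseP; rewrite eG; have [l lE fl] := fs E EF ED.
have lx : l != x by apply: contraNneq EC => lx; rewrite -CP // -lx.
have [xE|xE] := boolP (compl x \in E); last by exists l; rewrite // mem_resolve (negbTE xE).
have [lx'|lx'] := eqVneq l (compl x); last first.
  by exists l; rewrite // mem_resolve xE lx lx' lE orbT.
have [|k kC fk] := fs C CF; first by rewrite eq_sym.
exists k => //; rewrite mem_resolve xE kC /=; apply/and3P; split=> //.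
  by apply: contraTneq fk => ->; move: fl; rewrite lx' eval_compl.
by apply: contraTneq kC => ->; apply: compl_notin_main.
Qed.

End Main.

Lemma DP_sDP F x C : MU F -> unique_occ F x C -> DP x.1 F = sDP x C F.
Proof.
move=> mF uC; have [CF CP] := uC; have xC := unique_occ_mem uC.
have nxC := compl_notin_main mF uC.
have pair_eq : [fset (x.1, true); (x.1, false)] = [fset x; compl x].
  by case: x {uC CP xC nxC} => v [] //; rewrite fsetUC.
have occC D E y : D \in F -> E \in F -> y \in [:: x; compl x] ->
    D `&` complC E = [fset y] -> (D = C /\ compl x \in E) \/ (E = C /\ compl x \in D).
  move=> DF EF yx e; have : y \in D `&` complC E by rewrite e inE.
  rewrite inE mem_complC => /andP [yD yE]; move: yx yD yE; rewrite !inE => /orP [] /eqP ->.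
    by rewrite CP // => /eqP -> xE; left.
  by rewrite complK => xD; rewrite CP // => /eqP ->; right.
have xtrue : (x.1, true) \in [:: x; compl x].
  by rewrite !inE /compl; case: x {uC CP xC nxC pair_eq occC} => v []; rewrite eqxx ?orbT.
have resE D : D \in F -> compl x \in D -> C `&` complC D = [fset x] /\ D `&` complC C = [fset compl x].
  move=> DF xD; split; apply/fsetP => l; rewrite !inE mem_complC.
    apply/andP/eqP => [[lC lD]|->] //; exact: (MU_one_clash mF uC DF xD).
  apply/andP/eqP => [[lD lC]|->]; last by rewrite complK.
  by rewrite -[l]complK (MU_one_clash mF uC DF xD lC) ?complK.
apply/fsetP => E; apply/idP/sDP_P => [|[D /andP [DF DC] ->]].
  rewrite /DP inE => /orP [|/imfset2P [/= D DF [E' /=]]].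
    rewrite !inE => /andP [EF xE]; exists E.
      by rewrite EF; apply: contraNneq xE => ->; apply: mem_varC xC.
    by rewrite /resolve; case: ifP => // /mem_varC h; rewrite h in xE.
  rewrite inE => /andP [E'F /eqP e] ->; rewrite pair_eq.
  have [[eD xE']|[eE xD]] := occC D E' (x.1, true) DF E'F xtrue e.
    exists E'; last by rewrite /resolve xE' eD.
    by rewrite E'F (side_neq_main mF uC).
  exists D; last by rewrite /resolve xD eE fsetUC.
  by rewrite DF (side_neq_main mF uC).
rewrite /DP inE pair_eq /resolve; case: ifP => xD.
  apply/orP; right; apply/imfset2P.
  (* [DP] lists the clause with the positive literal first, so the sign of [x] decides the place of
     [C]. *)
  have [e1 e2] := resE D DF xD; case: (boolP x.2) => x2.
    exists C; rewrite //; exists D; rewrite // inE /= DF e1.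
    by apply/eqP; congr [fset _]; case: (x) x2 => v [].
  exists D => //=; exists C; last by rewrite fsetUC.
  rewrite inE /= CF e2; apply/eqP; congr [fset _].
  by case: (x) x2 => v [].
apply/orP; left; rewrite !inE DF /=; apply/negP => /varCP [l lD /lit_var_eq].
by case/orP => /eqP e; rewrite e in lD; [rewrite CP // (negbTE DC) in lD | rewrite xD in lD].
Qed.

Lemma sDP_step_unique F v : MU F -> singular F v ->
  exists x C, [/\ x.1 = v, unique_occ F x C & DP v F = sDP x C F].
Proof.
move=> mF /singularP - /(_ mF) [x xv /unique_occP [C uC]].
by exists x, C; split=> //; rewrite -xv; apply: DP_sDP.
Qed.

(** * Effect of one step on clauses and variables *)

Section Count.

Variables (F : clauseset) (x : lit) (C : clause).
Hypotheses (mF : MU F) (uC : unique_occ F x C).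

Lemma card_sDP : #|`F| = #|`sDP x C F|.+1.
Proof.
rewrite card_in_imfset /=; last exact: (resolve_inj mF uC).
by have [CF _] := uC; rewrite (cardfsD1 C F) CF.
Qed.

(** Some clause contains [compl x], and its resolvent inherits the other literals of [C], so no
    other variable is lost. *)
Lemma varF_sDP : varF (sDP x C F) = varF F `\ x.1.
Proof.
have [CF CP] := uC; have nxC := compl_notin_main mF uC.
apply/fsetP => u; rewrite !inE; apply/varFP/andP => [[E /sDP_P [D /andP [DF DC] ->]]|].
  case=> l; rewrite mem_resolve; case: ifP => xD; last first.
    move=> lD <-; split; last exact: mem_varF lD.
    apply/negP => /eqP /lit_var_eq /orP [] /eqP e; last by rewrite -e lD in xD.
    by move: lD; rewrite e CP // (negbTE DC).
  case/and3P => lx lx' h <-; split.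
    by apply/negP => /eqP /lit_var_eq; rewrite (negbTE lx) (negbTE lx').
  by case/orP: h => h; [apply: (mem_varF CF) | apply: (mem_varF DF)].
case=> ux /varFP [D DF [l lD lu]].
have lx : l != x by apply: contraNneq ux => <-; rewrite lu.
have lx' : l != compl x by apply: contraNneq ux => e; rewrite -lu e.
have [eD|DC] := eqVneq D C; last first.
  exists (resolve x C D); first by apply/sDP_P; exists D; rewrite // DF.
  by exists l; rewrite // mem_resolve lx lx' lD orbT; case: ifP.
have [E EF xE] := ex_side mF uC; exists (resolve x C E).
  by apply/sDP_P; exists E; rewrite // EF (side_neq_main mF uC).
by exists l; rewrite // mem_resolve xE lx lx' -eD lD.
Qed.

Lemma nvars_sDP : nvars F = (nvars (sDP x C F)).+1.
Proof.
rewrite /nvars varF_sDP (cardfsD1 x.1 (varF F)).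
by have [CF _] := uC; rewrite (mem_varF CF (unique_occ_mem uC)).
Qed.

Lemma unique_occ_sDP y M : unique_occ F y M -> M != C -> y.1 != x.1 ->
  unique_occ (sDP x C F) y (resolve x C M).
Proof.
move=> [MF MP] MC yx; split; first by apply/sDP_P; exists M; rewrite // MF.
move=> E /sDP_P [D /andP [DF DC] ->].
rewrite (inj_in_eq (resolve_inj mF uC)) ?inE ?DF ?DC ?MF ?MC // mem_resolve.
have [CF CP] := uC; rewrite (MP C CF) [C == M]eq_sym (negbTE MC) /= MP //.
have -> : y != x by apply: contraNneq yx => ->.
by have -> : y != compl x; [apply: contraNneq yx => -> | case: ifP].
Qed.

End Count.

(* Both orders of resolution act on the clauses other than [C] and [M] by the
   same map. *)
Lemma sDP_comm F x C y M : MU F -> unique_occ F x C -> unique_occ F y M ->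
  M != C -> y.1 != x.1 ->
  sDP y (resolve x C M) (sDP x C F) = sDP x (resolve y M C) (sDP y M F).
Proof.
move=> mF uC uM MC yx.
have mapE a A b B : unique_occ F a A -> unique_occ F b B -> B != A -> forall E,
    (E \in sDP b (resolve a A B) (sDP a A F)) <->
    exists D, [/\ D \in F, D != A, D != B & E = resolve b (resolve a A B) (resolve a A D)].
  move=> uA uB BA E; have injA := resolve_inj mF uA; have [BF _] := uB.
  split=> [/sDP_P [G /andP [/sDP_P [D /andP [DF DA] ->]] ne ->]|[D [DF DA DB ->]]].
    by exists D; split=> //; apply: contraNneq ne => ->.
  apply/sDP_P; exists (resolve a A D) => //; apply/andP; split.
    by apply/sDP_P; exists D; rewrite // DF.
  by apply: contraNneq DB => e; apply/eqP/injA; rewrite ?in_fsetD1 ?DA ?DF ?BA ?BF.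
suff eqr D : D \in F -> D != C -> D != M ->
    resolve y (resolve x C M) (resolve x C D) = resolve x (resolve y M C) (resolve y M D).
  apply/fsetP => E; apply/idP/idP => /mapE.
    move=> /(_ uC uM MC) [D [DF DC DM ->]]; apply/mapE => //; first by rewrite eq_sym.
    by exists D; split=> //; apply: eqr.
  rewrite eq_sym => /(_ uM uC MC) [D [DF DM DC ->]]; apply/mapE => //.
  by exists D; split=> //; rewrite eqr.
move=> DF DC DM; have [CF CP] := uC; have [MF MP] := uM.
have xD : x \notin D by rewrite CP.
have yD : y \notin D by rewrite MP.
have xM : x \notin M by rewrite CP.
have yC : y \notin C by rewrite MP // eq_sym.
have nxC := compl_notin_main mF uC; have nyM := compl_notin_main mF uM.
have n1 : (compl y == x) = false by apply: contraNF yx => /eqP <-.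
have n2 : (compl y == compl x) = false by apply: contraNF yx => /eqP e; rewrite -[y.1]/((compl y).1) e.
have n3 : (compl x == y) = false by apply: contraNF yx => /eqP <-.
have n4 : (compl x == compl y) = false by rewrite eq_sym.
apply/fsetP => l; rewrite !mem_resolve n1 n2 n3 n4 /=.
have [->|lx] := eqVneq l x.
  by rewrite (negbTE xD) (negbTE xM) /=; case: (compl x \in D) (compl x \in M) (compl y \in C) (compl y \in D) => [] [] [] [] //=;
    rewrite ?andbF ?andFb ?orbF.
have [->|lx'] := eqVneq l (compl x).
  by rewrite (negbTE nxC) n3 n4 /=; case: (compl x \in D) (compl x \in M) (compl y \in C) (compl y \in D) => [] [] [] [] //=;
    rewrite ?andbF ?andFb ?orbF.
have [->|ly] := eqVneq l y.
  by rewrite (negbTE yD) (negbTE yC) /=; case: (compl x \in D) (compl x \in M) (compl y \in C) (compl y \in D) => [] [] [] [] //=;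
    rewrite ?andbF ?andFb ?orbF.
have [->|ly'] := eqVneq l (compl y).
  by rewrite (negbTE nyM) /=; case: (compl x \in D) (compl x \in M) (compl y \in C) (compl y \in D) => [] [] [] [] //=;
    rewrite ?andbF ?andFb ?orbF.
rewrite /=; case: (compl x \in D) (compl y \in D) (compl x \in M) (compl y \in C) => [] [] [] [] //=;
  by case: (l \in C) (l \in D) (l \in M) => [] [] [].
Qed.

(** * Degrees after a step and the number of steps *)

Lemma ldeg_sDP F x C y : MU F -> unique_occ F x C ->
  ldeg (sDP x C F) y = #|`[fset D in F `\ C | y \in resolve x C D]|.
Proof.
move=> mF uC; have inj := resolve_inj mF uC; set S := [fset D in _ | _].
have SE D : (D \in S) = (D \in F `\ C) && (y \in resolve x C D) by rewrite in_fset.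
rewrite /ldeg -/(occ _ y); have -> : occ (sDP x C F) y = [fset resolve x C D | D in S].
  apply/fsetP => E; apply/idP/imfsetP => /= [|[D]].
    by rewrite occE => /andP [/imfsetP [/= D DFC ->] yD]; exists D; rewrite // SE DFC.
  rewrite SE => /andP [DFC yD] ->; rewrite occE yD andbT.
  by apply/imfsetP; exists D.
rewrite card_in_imfset //= => D E; rewrite !SE => /andP [DFC _] /andP [EFC _].
exact: inj.
Qed.

(** A literal of [C] is copied into at least two resolvents; a literal outside [C] keeps its
    degree. *)
Lemma ldeg_sDP_eq1 F x C y : MU F -> unique_occ F x C -> ldeg F (compl x) != 1 ->
  y.1 != x.1 -> (ldeg (sDP x C F) y == 1) = (y \notin C) && (ldeg F y == 1).
Proof.
move=> mF uC d2 yx; rewrite (ldeg_sDP _ mF uC).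
have yx1 : y != x by apply: contraNneq yx => ->.
have yx2 : y != compl x by apply: contraNneq yx => ->.
case: (boolP (y \in C)) => yC /=; last first.
  congr (_ == 1); congr #|` _|; apply/fsetP => D.
  rewrite -/(occ F y) occE !inE mem_resolve yx1 yx2 (negbTE yC) /= if_same.
  by case: (D =P C) => [->|_] /=; rewrite ?(negbTE yC) ?andbF.
apply/negbTE; rewrite neq_ltn; apply/orP; right.
apply: (@leq_trans (ldeg F (compl x))).
  have [E EF xE] := ex_side mF uC; rewrite ltn_neqAle eq_sym d2.
  by apply/ldeg_gt0P; exists E.
apply: fsubset_leq_card; apply/fsubsetP => D; rewrite !inE => /andP [DF xD].
by rewrite DF (side_neq_main mF uC) // mem_resolve xD yx1 yx2 yC.
Qed.

Definition mains F : clauseset := [fset D in F | [exists y : D, ldeg F (val y) == 1]].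

Lemma mainsP F D :
  reflect (D \in F /\ exists2 y, y \in D & ldeg F y = 1) (D \in mains F).
Proof.
rewrite !inE; apply: (iffP andP) => -[DF].
  by case/existsP => y /eqP dy; split=> //; exists (val y); rewrite ?fsvalP.
by case=> y yD dy; split=> //; apply/existsP; exists [`yD]; rewrite /= dy.
Qed.

Definition no_1singular F : Prop := forall x, ldeg F x = 1 -> ldeg F (compl x) != 1.

(** Literals of degree 1 outside [C] keep it and no new ones arise, so the main clauses of the
    reduct are the images of those other than [C]. *)
Lemma no_1singular_sDP F x C : MU F -> unique_occ F x C -> no_1singular F ->
  no_1singular (sDP x C F) /\ #|`mains F| = #|`mains (sDP x C F)|.+1.
Proof.
move=> mF uC n1; have [CF CP] := uC; have xC := unique_occ_mem uC.
have dx : ldeg F x = 1 by apply/unique_occP; exists C.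
have dx' := n1 x dx.
have d0 y : y.1 = x.1 -> ldeg (sDP x C F) y = 0.
  by move=> yx; apply: ldeg_notin; rewrite (varF_sDP mF uC) !inE yx eqxx.
have d1 y : ldeg (sDP x C F) y = 1 -> [/\ y.1 != x.1, y \notin C & ldeg F y = 1].
  move=> dy; have yx : y.1 != x.1 by apply/eqP => /d0; rewrite dy.
  by have := ldeg_sDP_eq1 mF uC dx' yx; rewrite dy => /esym/andP [yC /eqP].
split.
  move=> y /d1 [yx yC dy]; apply: contra (n1 y dy) => /eqP /d1 [_ _ dy'].
  by rewrite dy'.
have -> : mains (sDP x C F) = [fset resolve x C D | D in mains F `\ C].
  apply/fsetP => E; apply/mainsP/imfsetP => /= [[/sDP_P [D /andP [DF DC] ->]]|[D]].
    case=> y yD /d1 [yx yC dy]; exists D => //; rewrite in_fsetD1 DC; apply/mainsP.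
    split=> //; exists y => //; move: yD; rewrite mem_resolve (negbTE yC) /=.
    by case: ifP => // _ /and3P [].
  rewrite in_fsetD1 => /andP [DC /mainsP [DF [y yD dy]]] ->.
  split; first by apply/sDP_P; exists D; rewrite // DF.
  have yC : y \notin C.
    move/unique_occP: dy => [M [MF MP]]; rewrite MP // eq_sym; apply: contra DC.
    by move=> /eqP <-; rewrite -MP.
  have yx : y.1 != x.1.
    apply/eqP => /lit_var_eq /orP [] /eqP e; first by rewrite e xC in yC.
    by rewrite -e dy in dx'.
  exists y; last by apply/eqP; rewrite (ldeg_sDP_eq1 mF uC) // yC dy.
  rewrite mem_resolve yD orbT; case: ifP => // _; apply/and3P; split=> //.
    by apply: contraNneq yx => ->.
  by apply: contraNneq yx => ->.
have sub D : D \in mains F `\ C -> D \in F `\ C.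
  by rewrite !in_fsetD1 => /andP [-> /mainsP [->]].
have -> : #|`[fset resolve x C D | D in mains F `\ C]| = #|`mains F `\ C|.
  by apply: card_in_imfset => D E hD hE; apply: (resolve_inj mF uC); apply: sub.
rewrite (cardfsD1 C (mains F)); suff -> : C \in mains F by [].
by apply/mainsP; split=> //; exists x.
Qed.

Lemma in_sDP_inv F F1 : MU F -> in_sDP F F1 ->
  nonsingular F /\ F1 = F \/
  exists x C, unique_occ F x C /\ in_sDP (sDP x C F) F1.
Proof.
move=> mF [r [mF1 nF1]]; case: r mF nF1 mF1 => [G|G _ H [mG [v [sv ->]]] r] _ nH mH; first by left.
have [x [C [_ uC e]]] := sDP_step_unique mG sv.
by right; exists x, C; rewrite -e.
Qed.

Lemma unique_occ_singular F x C : MU F -> unique_occ F x C -> singular F x.1.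
Proof.
move=> mF uC; apply/(singularP _ mF); exists x => //; apply/unique_occP; by exists C.
Qed.

Lemma in_sDP_step F x C F1 : MU F -> unique_occ F x C ->
  in_sDP (sDP x C F) F1 -> in_sDP F F1.
Proof.
move=> mF uC [r [mF1 nF1]]; split=> //; apply: sDP_trans r; split=> //.
by exists x.1; split; [apply: unique_occ_singular uC | rewrite (DP_sDP mF uC)].
Qed.

Lemma in_sDP_exists F : MU F -> exists F1, in_sDP F F1.
Proof.
have [k] := ubnP (nvars F); elim: k F => // k IH F; rewrite ltnS => leF mF.
case: (classic (nonsingular F)) => [nF|nF]; first by exists F; split=> //; apply: sDP_refl.
have [v sv] : exists v, singular F v.
  by apply: NNPP => h; apply: nF => v sv; apply: h; exists v.
have [x [C [_ uC e]]] := sDP_step_unique mF sv.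
have := nvars_sDP mF uC => eF.
have [|F1 h] := IH (sDP x C F) _ (MU_sDP mF uC); first by lia.
by exists F1; apply: in_sDP_step h.
Qed.

Lemma in_sDP_deficiency F F1 : MU F -> in_sDP F F1 ->
  ncls F1 + nvars F = ncls F + nvars F1.
Proof.
have [k] := ubnP (nvars F); elim: k F => // k IH F; rewrite ltnS => leF mF.
case/(in_sDP_inv mF) => [[_ ->]|[x [C [uC h]]]] //.
have eF := nvars_sDP mF uC; have cF := card_sDP mF uC.
have := IH (sDP x C F) _ (MU_sDP mF uC) h; rewrite /ncls in cF *.
by lia.
Qed.

Lemma in_sDP_mains F F1 : MU F -> no_1singular F -> in_sDP F F1 ->
  nvars F1 + #|`mains F| = nvars F.
Proof.
have [k] := ubnP (nvars F); elim: k F => // k IH F; rewrite ltnS => leF mF n1.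
case/(in_sDP_inv mF) => [[nF ->]|[x [C [uC h]]]].
  suff -> : mains F = fset0 by rewrite cardfs0 addn0.
  apply/fsetP => D; rewrite in_fset0; apply/negP => /mainsP [DF [y yD dy]].
  by apply: (nF y.1); apply/(singularP _ mF); exists y.
have eF := nvars_sDP mF uC; have [n1' em] := no_1singular_sDP mF uC n1.
by have := IH (sDP x C F) _ (MU_sDP mF uC) n1' h; lia.
Qed.

(** Without (1,1)-variables the main clauses count the steps; otherwise such a variable is
    eliminated first and induction applies to that reduct. *)
Lemma in_sDP_nvars F F1 F2 : MU F -> in_sDP F F1 -> in_sDP F F2 -> nvars F1 = nvars F2.
Proof.
have [k] := ubnP (nvars F); elim: k F F1 F2 => // k IH F F1 F2; rewrite ltnS => leF mF.
case: (classic (no_1singular F)) => [n1 h1 h2|n1].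
  by have := in_sDP_mains mF n1 h1; have := in_sDP_mains mF n1 h2; lia.
have [x [/unique_occP [C uC] /unique_occP [D uD]]] :
    exists x, ldeg F x = 1 /\ ldeg F (compl x) = 1.
  apply: NNPP => nx; apply: n1 => x dx; apply/eqP => dx'; apply: nx; exists x.
  by split.
have DC : D != C by apply: (side_neq_main mF uC); apply: unique_occ_mem uD.
have IH' a A G1 G2 : unique_occ F a A -> in_sDP (sDP a A F) G1 ->
    in_sDP (sDP a A F) G2 -> nvars G1 = nvars G2.
  move=> uA; have eF := nvars_sDP mF uA.
  by apply: IH; [lia | apply: MU_sDP uA].
(* [G'] is a result of the common two-step reduct. It is also a result of the reduct at [y], as [G]
   is, so induction equates their numbers of variables. *)
have swap a A y M G : unique_occ F a A -> unique_occ F y M -> M != A -> y.1 != a.1 ->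
    in_sDP (sDP y M F) G -> exists2 G', in_sDP (sDP a A F) G' & nvars G' = nvars G.
  move=> uA uM MA ya hG; have mA := MU_sDP mF uA; have mM := MU_sDP mF uM.
  have uA' : unique_occ (sDP y M F) a (resolve y M A).
    by apply: unique_occ_sDP; rewrite // eq_sym.
  have uM' := unique_occ_sDP mF uA uM MA ya.
  have [G' hG'] := in_sDP_exists (MU_sDP mM uA').
  exists G'; last by apply: (IH' y M) => //; apply: in_sDP_step hG'.
  by apply: in_sDP_step uM' _; rewrite // sDP_comm.
have first G : in_sDP F G -> exists2 G', in_sDP (sDP x C F) G' & nvars G' = nvars G.
  case/(in_sDP_inv mF) => [[nF _]|[y [M [uM hG]]]].
    by case: (nF x.1); apply: unique_occ_singular uC.
  (* Both main clauses of the (1,1)-variable give the same reduct; [D] is used when [C] is the main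
     clause of [y]. *)
  have eD : sDP x C F = sDP (compl x) D F by rewrite -(DP_sDP mF uC) -(DP_sDP mF uD).
  have [yx|yx] := eqVneq y.1 x.1.
    by exists G; rewrite // -(DP_sDP mF uC) -yx (DP_sDP mF uM).
  have [MC|MC] := eqVneq M C; last exact: swap hG.
  by rewrite eD; apply: swap hG; rewrite // MC eq_sym.
move=> /first [G1 h1 <-] /first [G2 h2 <-]; exact: IH' h1 h2.
Qed.

Lemma nonsingular_MU F : MU F -> nonsingular F -> ncls F = nvars F + 2 -> nonsingular2 F.
Proof.
move=> mF nF cF; have /MU_rMU [clF rF] := mF; split=> // x xF.
have := MU_ldeg_gt0 mF xF; rewrite leq_eqVlt => /orP [/eqP d|//].
by case: (nF x.1); apply/(singularP _ mF); exists x.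
Qed.

Theorem theorem74 (F : clauseset) :
  MU F -> ncls F = nvars F + 2 ->
  forall F1 F2 : clauseset, in_sDP F F1 -> in_sDP F F2 -> isomorphic F1 F2.
Proof.
move=> mF cF F1 F2 h1 h2; have en := in_sDP_nvars mF h1 h2.
have d1 := in_sDP_deficiency mF h1; have d2 := in_sDP_deficiency mF h2.
have [_ [m1 n1]] := h1; have [_ [m2 n2]] := h2.
(* Deficiency 2 is preserved, so both results are cycles, of equal length since their numbers of
   variables agree. *)
have [|s [us es ->]] := nonsingular2_cycle (nonsingular_MU m1 n1 _); first by lia.
have [|t [ut et ->]] := nonsingular2_cycle (nonsingular_MU m2 n2 _); first by lia.
by apply: cycle_clauses_isomorphic; rewrite // es et.
Qed.
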